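(* Let $(X,b,m)$ be a connected weighted graph satisfying conditions (B) and (M). Let $\Omega\subset X$ be non-empty with $\Omega\ne X$, and assume $\mathrm{vol}(\Omega)<\infty$ and $\mathrm{Inr}(\Omega)<\infty$. Then: (a) $\displaystyle \lambda_\Omega\ge \frac{1}{\mathrm{Inr}(\Omega)\,\mathrm{vol}(\Omega)}$. (b) If moreover $\mathrm{vol}(X)<\infty$, then $\displaystyle \lambda_\Omega\le \|H\|\,\frac{\mathrm{vol}(X)-\mathrm{vol}(\Omega)}{\mathrm{vol}(X)}$.
   Context: A weighted graph $(X,b,m)$ consists of a countable set $X$, a symmetric function $b:X\times X\to[0,\infty)$ with $b(x,x)=0$ and $\sum_{y}b(x,y)<\infty$ for all $x$, and $m:X\to(0,\infty)$; $\mathrm{vol}(A):=\sum_{x\in A}m(x)$. Condition (B): $\delta:=\sup_{x}\frac{1}{m(x)}\sum_{y}b(x,y)<\infty$. Condition (M): $\sup_x m(x)<\infty$. On $\ell^2(X,m)=\{f:X\to\mathbb{C}: \sum_x|f(x)|^2m(x)<\infty\}$ consider the bounded form $\mathcal{E}(f,g)=\frac12\sum_{x,y}b(x,y)(f(x)-f(y))(\overline{g(x)}-\overline{g(y)})$ and the associated bounded selfadjoint operator $(Hf)(x)=\frac{1}{m(x)}\sum_y b(x,y)(f(x)-f(y))$. A path is $\gamma=(x_0,\dots,x_k)$ with $b(x_j,x_{j+1})>0$, of length $L(\gamma)=\sum_{j=0}^{k-1}1/b(x_j,x_{j+1})$ (trivial paths have length $0$); connected means any two points are joined by a path; $d(x,y)$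 is the infimum of lengths of paths from $x$ to $y$, and $U_r(x):=\{y: d(x,y)<r\}$. For $\Omega\subset X$, identify $\ell^2(\Omega,m)$ with $\{f\in\ell^2(X,m): f=0 \text{ on } X\setminus\Omega\}$; $\mathcal{E}_\Omega$ is the restriction of $\mathcal{E}$ to this space, $H_\Omega$ the associated selfadjoint operator on $\ell^2(\Omega,m)$ (the Dirichlet Laplacian), and $\lambda_\Omega:=\min\sigma(H_\Omega)$. The inradius is $\mathrm{Inr}(\Omega):=\sup\{r>0:\exists x\in\Omega \text{ with } U_r(x)\subset\Omega\}$. *)

(* Defs.v *)
From HB Require Import structures.
From mathcomp Require Import all_boot all_order all_algebra.
From mathcomp Require Import all_classical all_reals.
From mathcomp Require Import ereal esum.
Set Implicit Arguments. Unset Strict Implicit. Unset Printing Implicit Defensive.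
Import Order.TTheory GRing.Theory Num.Theory.
Local Open Scope classical_set_scope.
Local Open Scope ring_scope.

Section Defs.
Variables (R : realType) (X : countType).

Definition nsum (f : X -> R) : \bar R := \esum_(x in [set: X]) (f x)%:E.

(** Sum over X of a (absolutely summable) real function: positive part minus
    negative part. *)
Definition rsum (f : X -> R) : R :=
  fine (nsum (fun x => Num.max (f x) 0)) - fine (nsum (fun x => Num.max (- f x) 0)).

Definition vol (m : X -> R) (A : set X) : \bar R := \esum_(x in A) (m x)%:E.

Definition weighted_graph (b : X -> X -> R) (m : X -> R) : Prop :=
  (forall x y, 0 <= b x y) /\ (forall x y, b x y = b y x) /\
  (forall x, b x x = 0) /\ (forall x, (nsum (b x) < +oo)%E) /\
  (forall x, 0 < m x).

Definition condB (b : X -> X -> R) (m : X -> R) : Prop :=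
  exists C : R, forall x, fine (nsum (b x)) / m x <= C.

Definition condM (m : X -> R) : Prop := exists C : R, forall x, m x <= C.

(** A path x = x_0, x_1, ..., x_k given by its start x and the list
    [x_1; ...; x_k]; consecutive vertices must satisfy b > 0. *)
Definition is_gpath (b : X -> X -> R) (x : X) (p : seq X) : bool :=
  path (fun u v => 0 < b u v) x p.

Fixpoint plength (b : X -> X -> R) (x : X) (p : seq X) : R :=
  match p with
  | [::] => 0
  | y :: q => (b x y)^-1 + plength b y q
  end.

Definition connected_graph (b : X -> X -> R) : Prop :=
  forall x y, exists p, is_gpath b x p /\ last x p = y.

Definition gdist (b : X -> X -> R) (x y : X) : R :=
  inf [set plength b x p | p in [set p | is_gpath b x p /\ last x p = y]].

Definition ball_d (b : X -> X -> R) (x : X) (r : R) : set X :=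
  [set y | gdist b x y < r].

(** inradius, in [-oo, +oo] (it is finite and positive in the setting) *)
Definition inradius (b : X -> X -> R) (Om : set X) : \bar R :=
  ereal_sup [set r%:E | r in [set r : R | 0 < r /\
                 exists x, Om x /\ ball_d b x r `<=` Om]].

Definition l2 (m : X -> R) (f : X -> R) : Prop :=
  (nsum (fun x => (f x ^+ 2 * m x)%R) < +oo)%E.

Definition l2norm (m : X -> R) (f : X -> R) : R :=
  Num.sqrt (fine (nsum (fun x => f x ^+ 2 * m x))).

Definition Hop (b : X -> X -> R) (m : X -> R) (f : X -> R) (x : X) : R :=
  (m x)^-1 * rsum (fun y => b x y * (f x - f y)).

(** Complex-valued functions X -> C are represented by pairs (Re f, Im f). *)
Definition cfun := ((X -> R) * (X -> R))%type.

(** complex l^2(Om, m), identified with the functions in l^2(X,m) vanishing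
    outside Om *)
Definition l2C (m : X -> R) (Om : set X) (u : cfun) : Prop :=
  l2 m u.1 /\ l2 m u.2 /\ (forall x, ~ Om x -> u.1 x = 0 /\ u.2 x = 0).

Definition l2Cnorm (m : X -> R) (u : cfun) : R :=
  Num.sqrt (l2norm m u.1 ^+ 2 + l2norm m u.2 ^+ 2).

(** H acting on complex functions (H is real: H(f + i g) = H f + i H g). *)
Definition HC (b : X -> X -> R) (m : X -> R) (u : cfun) : cfun :=
  (Hop b m u.1, Hop b m u.2).

Definition Hnorm (b : X -> X -> R) (m : X -> R) : R :=
  sup [set l2Cnorm m (HC b m u) | u in [set u | l2C m setT u /\ l2Cnorm m u <= 1]].

(** Dirichlet Laplacian H_Om on l^2(Om,m): (H_Om f)(x) = (H f)(x) for x in Om,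
    and 0 outside Om (the operator associated with the restricted form). *)
Definition HDir (b : X -> X -> R) (m : X -> R) (Om : set X) (f : X -> R) (x : X) : R :=
  if `[< Om x >] then Hop b m f x else 0.

(** H_Om - z for z = a + i c, acting on complex functions:
    (H_Om - z)(f + i g) = (H_Om f - a f + c g) + i (H_Om g - a g - c f). *)
Definition HDir_shift (b : X -> X -> R) (m : X -> R) (Om : set X) (z : R * R)
  (u : cfun) : cfun :=
  (fun x => HDir b m Om u.1 x - z.1 * u.1 x + z.2 * u.2 x,
   fun x => HDir b m Om u.2 x - z.1 * u.2 x - z.2 * u.1 x).

Definition resolvent (b : X -> X -> R) (m : X -> R) (Om : set X) (z : R * R) : Prop :=
  exists S : cfun -> cfun,
    (forall u, l2C m Om u ->
       [/\ l2C m Om (S u), S (HDir_shift b m Om z u) = u &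
           HDir_shift b m Om z (S u) = u]) /\
    exists C : R, forall u, l2C m Om u -> l2Cnorm m (S u) <= C * l2Cnorm m u.

Definition spectrum (b : X -> X -> R) (m : X -> R) (Om : set X) : set (R * R) :=
  [set z | ~ resolvent b m Om z].

(** lambda_Om = min sigma(H_Om) (the spectrum is real; we take the infimum of
    real parts, which is attained). *)
Definition lambda (b : X -> X -> R) (m : X -> R) (Om : set X) : R :=
  inf [set z.1 | z in spectrum b m Om].

End Defs.

(* Main.v *)
Require Import Defs.
From HB Require Import structures.
From mathcomp Require Import all_boot all_order all_algebra.
From mathcomp Require Import all_classical all_reals.
From mathcomp Require Import ereal esum.
From mathcomp Require Import ring lra.
Set Implicit Arguments. Unset Strict Implicit. Unset Printing Implicit Defensive.
Import Order.TTheory GRing.Theory Num.Theory.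
Local Open Scope classical_set_scope.
Local Open Scope ring_scope.

(** Lower bound.  A vertex [x] of [Om] is joined to the complement of [Om] by a
    path of length less than any prescribed [r > Inr(Om)].  Removing loops makes
    the path simple, and Cauchy-Schwarz along it gives [f(x)^2 <= r E(f)] for
    every [f] vanishing off [Om]; summing against [m] yields
    [|f|^2 <= Inr(Om) vol(Om) E(f)].  Hence [H_Om - z] is coercive as soon as
    [Re z < 1 / (Inr(Om) vol(Om))], and [u |-> u - t ((H_Om - z) u - w)] is a
    contraction for small [t > 0], so that such a [z] is in the resolvent set.

    Upper bound.  The infimum [mu] of the Rayleigh quotients belongs to the
    spectrum: [A = H_Om - mu] is nonnegative, so [|A f|^2 <= |A| <A f, f>], and a
    bounded inverse of [A] would make the quotients exceed [mu] by a fixed amount.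
    It remains to test with the indicator of [Om], noting that adding a constant
    does not change the form: subtracting its mean [vol(Om) / vol(X)] gives a
    function of squared norm [vol(Om) (vol(X) - vol(Om)) / vol(X)]. *)

(** * Absolutely summable families *)

Section Sums.
Variables (R : realType) (X : countType).
Implicit Types f g h : X -> R.

Lemma sum_le_nsum f (s : seq X) : uniq s ->
  ((\sum_(x <- s) f x)%:E <= nsum f)%E.
Proof.
move=> us; rewrite -sumEFin fsbig_seq//; apply: ereal_sup_ubound.
by exists [set` s] => //; split; [exact: finite_seq|].
Qed.

Lemma nsum_le f (M : R) :
  (forall s : seq X, uniq s -> \sum_(x <- s) f x <= M) -> (nsum f <= M%:E)%E.
Proof.
move=> fM; apply: ge_ereal_sup => _ [A [finA _] <-].
by rewrite fsbig_finite// sumEFin lee_fin; apply: fM; exact: finmap.fset_uniq.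
Qed.

Lemma nsum_ge0 f : (forall x, 0 <= f x) -> (0 <= nsum f)%E.
Proof. by move=> f0; apply: esum_ge0 => x _; rewrite lee_fin. Qed.

Lemma nsum_mono f g : (forall x, f x <= g x) -> (nsum f <= nsum g)%E.
Proof. by move=> fg; apply: le_esum => x _; rewrite lee_fin. Qed.

Lemma nsum_fin_num f : (forall x, 0 <= f x) -> (nsum f < +oo)%E ->
  nsum f \is a fin_num.
Proof. by move=> f0 foo; rewrite ge0_fin_numE// nsum_ge0. Qed.

Lemma nsumD f g : (forall x, 0 <= f x) -> (forall x, 0 <= g x) ->
  nsum (fun x => f x + g x) = (nsum f + nsum g)%E.
Proof.
move=> f0 g0; rewrite /nsum -esumD; try by move=> x _; rewrite lee_fin.
by apply: eq_esum => x _; rewrite EFinD.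
Qed.

Definition summ f := (nsum (fun x => `|f x|%R) < +oo)%E.

Lemma summ_bounded f (M : R) :
  (forall s : seq X, uniq s -> \sum_(x <- s) `|f x| <= M) -> summ f.
Proof. by move=> /nsum_le fM; apply: le_lt_trans fM (ltry _). Qed.

Lemma summ_le g f : summ g -> (forall x, `|f x| <= g x) -> summ f.
Proof.
move=> sg fg; apply: le_lt_trans sg; apply: nsum_mono => x.
exact: le_trans (fg x) (ler_norm _).
Qed.

Lemma summ_ge0 f : (forall x, 0 <= f x) -> summ f <-> (nsum f < +oo)%E.
Proof.
by move=> f0; rewrite /summ; under eq_fun do rewrite ger0_norm//.
Qed.

Lemma summ_fin_num f : (forall x, 0 <= f x) -> summ f -> nsum f \is a fin_num.
Proof. by move=> f0 sf; exact: nsum_fin_num f0 (proj1 (summ_ge0 f0) sf). Qed.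

Lemma summ_abs f : summ f -> summ (fun x => `|f x|).
Proof. by move=> sf; rewrite /summ; under eq_fun do rewrite normr_id. Qed.

Lemma summD f g : summ f -> summ g -> summ (fun x => f x + g x).
Proof.
move=> sf sg; apply: (@summ_le (fun x => `|f x| + `|g x|)); last first.
  by move=> x; exact: ler_normD.
apply/summ_ge0; first by move=> x; exact: addr_ge0.
by rewrite nsumD//; exact: lte_add_pinfty.
Qed.

Lemma summN f : summ f -> summ (fun x => - f x).
Proof. by move=> sf; apply: summ_le (summ_abs sf) _ => x; rewrite normrN. Qed.

Lemma summB f g : summ f -> summ g -> summ (fun x => f x - g x).
Proof. by move=> sf /summN; exact: summD. Qed.

(** Only one inequality is recorded: applied to a positive scalar and then to its inverse it yields
    the equality of [rsumZ]. *)
Lemma nsumZ_le (c : R) f : 0 <= c -> summ f -> (forall x, 0 <= f x) ->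
  (nsum (fun x => (c * f x)%R) <= (c * fine (nsum f))%:E)%E.
Proof.
move=> c0 sf f0; apply: nsum_le => s us; rewrite -mulr_sumr ler_wpM2l//.
by rewrite -lee_fin fineK ?sum_le_nsum ?summ_fin_num.
Qed.

Lemma summZ (c : R) f : summ f -> summ (fun x => c * f x).
Proof.
move=> sf; apply: (@summ_le (fun x => `|c| * `|f x|)); last first.
  by move=> x; rewrite normrM.
apply/summ_ge0; first by move=> x; rewrite mulr_ge0.
apply: le_lt_trans (ltry _); apply: nsumZ_le => //; exact: summ_abs.
Qed.

Lemma fine_nsumD f g : (forall x, 0 <= f x) -> (forall x, 0 <= g x) ->
  summ f -> summ g ->
  fine (nsum (fun x => f x + g x)) = fine (nsum f) + fine (nsum g).
Proof.
by move=> f0 g0 sf sg; rewrite nsumD// fineD// summ_fin_num.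
Qed.

Lemma summ_pos f : summ f -> summ (fun x => Num.max (f x) 0).
Proof.
move=> sf; apply: summ_le (summ_abs sf) _ => x.
by rewrite ger0_norm ?le_max ?lexx ?orbT// ge_max ler_norm normr_ge0.
Qed.

Lemma maxr_posneg (a : R) : Num.max a 0 - Num.max (- a) 0 = a.
Proof. by case: (leP a 0); case: (leP (- a) 0); lra. Qed.

Lemma maxr0_ge0 f x : 0 <= Num.max (f x) 0.
Proof. by rewrite le_max lexx orbT. Qed.

(** The value of [rsum] does not depend on the decomposition: if f = g - h, then max(-f, 0) + g =
    max(f, 0) + h, and sums of nonnegative families are additive. *)
Lemma rsum_decomp f g h : (forall x, 0 <= g x) -> (forall x, 0 <= h x) ->
  summ g -> summ h -> (forall x, f x = g x - h x) ->
  rsum f = fine (nsum g) - fine (nsum h).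
Proof.
move=> g0 h0 sg sh fE.
have sf : summ f by rewrite (_ : f = fun x => g x - h x); [exact: summB|exact/funext].
have p0 := maxr0_ge0; have sp := summ_pos sf; have sn := summ_pos (summN sf).
have := fine_nsumD (p0 f) h0 sp sh; have := fine_nsumD (p0 (fun x => - f x)) g0 sn sg.
have -> : (fun x => Num.max (- f x) 0 + g x) = (fun x => Num.max (f x) 0 + h x).
  by apply/funext => x; have := maxr_posneg (f x); rewrite {3}fE; lra.
by rewrite /rsum => -> ?; lra.
Qed.

Lemma rsum_ge0E f : (forall x, 0 <= f x) -> rsum f = fine (nsum f).
Proof.
move=> f0; rewrite /rsum [X in _ - fine X](_ : _ = 0%E) /= ?subr0.
  by congr (fine (nsum _)); apply/funext => x; rewrite max_l.
by apply: esum1 => x _; rewrite max_r// oppr_le0.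
Qed.

Lemma rsum0 : rsum (fun _ : X => 0 : R) = 0.
Proof. by rewrite rsum_ge0E// /nsum esum1. Qed.

Lemma rsumB f g : (forall x, 0 <= f x) -> (forall x, 0 <= g x) ->
  summ f -> summ g -> rsum (fun x => f x - g x) = rsum f - rsum g.
Proof. by move=> f0 g0 sf sg; rewrite (rsum_decomp f0 g0)// !rsum_ge0E. Qed.

Lemma rsumD f g : summ f -> summ g ->
  rsum (fun x => f x + g x) = rsum f + rsum g.
Proof.
have p0 := maxr0_ge0.
move=> sf sg; rewrite (@rsum_decomp _
  (fun x => Num.max (f x) 0 + Num.max (g x) 0)
  (fun x => Num.max (- f x) 0 + Num.max (- g x) 0)).
- rewrite (fine_nsumD (p0 f) (p0 g)); try exact: summ_pos.
  rewrite (fine_nsumD (p0 (fun x => - f x)) (p0 (fun x => - g x))).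
  + by rewrite /rsum; ring.
  + by apply: summ_pos; exact: summN.
  + by apply: summ_pos; exact: summN.
- by move=> x; rewrite addr_ge0.
- by move=> x; rewrite addr_ge0// (p0 (fun x => - f x), p0 (fun x => - g x)).
- by apply: summD; exact: summ_pos.
- by apply: summD; apply: summ_pos; exact: summN.
- by move=> x; rewrite -{1}[f x]maxr_posneg -{1}[g x]maxr_posneg; ring.
Qed.

Lemma rsumN f : rsum (fun x => - f x) = - rsum f.
Proof.
rewrite /rsum opprB; congr (_ - fine (nsum _)).
by apply/funext => x; rewrite opprK.
Qed.

Lemma eq_rsum f g : f =1 g -> rsum f = rsum g.
Proof. by move=> /funext ->. Qed.

Lemma rsum_ge0 f : (forall x, 0 <= f x) -> 0 <= rsum f.
Proof. by move=> f0; rewrite rsum_ge0E// fine_ge0// nsum_ge0. Qed.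

Lemma ler_rsum f g : summ f -> summ g -> (forall x, f x <= g x) ->
  rsum f <= rsum g.
Proof.
move=> sf sg fg; rewrite -subr_ge0 -rsumN -rsumD//; last exact: summN.
by apply: rsum_ge0 => x; rewrite subr_ge0.
Qed.

(** Built up in stages: an inequality for a positive scalar and a nonnegative function, equality by
    means of the inverse scalar, signed functions through positive and negative parts, and last the
    other signs of the scalar. *)
Lemma rsumZ (c : R) f : summ f -> rsum (fun x => c * f x) = c * rsum f.
Proof.
have pos (d : R) g : 0 < d -> (forall x, 0 <= g x) -> summ g ->
    rsum (fun x => d * g x) <= d * rsum g.
  move=> d0 g0 sg; rewrite !rsum_ge0E => [|//|x]; last by rewrite mulr_ge0// ltW.
  rewrite -lee_fin fineK ?nsumZ_le ?ltW//.
  apply: nsum_fin_num => [x|]; first by rewrite mulr_ge0// ltW.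
  by apply: le_lt_trans (nsumZ_le (ltW d0) sg g0) (ltry _).
have pose (d : R) g : 0 < d -> (forall x, 0 <= g x) -> summ g ->
    rsum (fun x => d * g x) = d * rsum g.
  move=> d0 g0 sg; apply/eqP; rewrite eq_le pos//=.
  rewrite -ler_pdivlMl//; apply: le_trans (pos _ _ _ _ _).
  - by under [X in _ <= rsum X]eq_fun do rewrite mulKf ?gt_eqF//.
  - by rewrite invr_gt0.
  - by move=> x; rewrite mulr_ge0// ltW.
  - exact: summZ.
have posr (d : R) : 0 < d -> summ f -> rsum (fun x => d * f x) = d * rsum f.
  move=> d0 sf; have p0 := maxr0_ge0 f; have n0 := maxr0_ge0 (fun x => - f x).
  have sp := summ_pos sf; have sn := summ_pos (summN sf).
  rewrite (@rsum_decomp _ (fun x => d * Num.max (f x) 0)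
                          (fun x => d * Num.max (- f x) 0)).
  - rewrite -!rsum_ge0E ?pose//; try by move=> x; rewrite mulr_ge0// ltW.
    by rewrite -mulrBr; congr (_ * _); rewrite (rsum_ge0E p0) (rsum_ge0E n0).
  - by move=> x; rewrite mulr_ge0// ltW.
  - by move=> x; rewrite mulr_ge0// ltW.
  - exact: summZ.
  - exact: summZ.
  - by move=> x; rewrite -mulrBr maxr_posneg.
move=> sf; case: (ltgtP c 0) => [c0|c0|->]; last 2 first.
- exact: posr.
- by rewrite mul0r -[RHS]rsum0; apply: eq_rsum => x; rewrite mul0r.
- rewrite (_ : (fun x => c * f x) = (fun x => - (- c * f x))); last first.
    by apply/funext => x; rewrite mulNr opprK.
  by rewrite rsumN posr ?oppr_gt0// mulNr opprK.
Qed.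

Lemma sum_le_rsum f (s : seq X) : (forall x, 0 <= f x) -> summ f -> uniq s ->
  \sum_(x <- s) f x <= rsum f.
Proof.
by move=> f0 sf us; rewrite rsum_ge0E// -lee_fin fineK ?sum_le_nsum ?summ_fin_num.
Qed.

Lemma rsum_le f (M : R) : (forall x, 0 <= f x) ->
  (forall s : seq X, uniq s -> \sum_(x <- s) f x <= M) -> rsum f <= M.
Proof.
move=> f0 fM; have sf : summ f.
  apply: (@summ_bounded _ M) => s us; apply: le_trans (fM s us).
  by apply: ler_sum => x _; rewrite ger0_norm.
by rewrite rsum_ge0E// -lee_fin fineK ?nsum_le ?summ_fin_num.
Qed.

Lemma le_rsum1 f x : (forall y, 0 <= f y) -> summ f -> f x <= rsum f.
Proof.
by move=> f0 sf; have := @sum_le_rsum f [:: x] f0 sf; rewrite big_seq1; apply.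
Qed.

Lemma ler_norm_rsum f : summ f -> `|rsum f| <= rsum (fun x => `|f x|).
Proof.
move=> sf; have sa := summ_abs sf; rewrite ler_norml -rsumN; apply/andP; split.
  by apply: ler_rsum => //[|x]; [exact: summN|rewrite lerNl -normrN ler_norm].
by apply: ler_rsum => // x; exact: ler_norm.
Qed.

(** The hypothesis of Fubini's theorem, with the sum over the second variable taken first. *)
Definition summ2 (F : X -> X -> R) :=
  (forall x, summ (F x)) /\ summ (fun x => rsum (fun y => `|F x y|)).

(** Tonelli: both sides are one sum over pairs, reindexed by exchanging the coordinates. *)
Lemma nsum_swap (F : X -> X -> R) : (forall x y, 0 <= F x y) ->
  (\esum_(x in [set: X]) nsum (F x) =
   \esum_(y in [set: X]) nsum (fun x => F x y))%E.
Proof.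
move=> F0; rewrite /nsum !esum_esum; try by move=> *; rewrite lee_fin.
rewrite (@reindex_esum _ _ _ ([set: X] `*`` (fun=> [set: X])) _ (fun k => (k.2, k.1)))//.
split; [by []|by move=> [a c] [a' c'] _ _ [-> ->]|].
by move=> [a c] _; exists (c, a).
Qed.

Lemma summ2_le (G F : X -> X -> R) : summ2 G ->
  (forall x y, `|F x y| <= G x y) -> summ2 F.
Proof.
move=> [G1 G2] FG; have F1 x : summ (F x) by apply: summ_le (G1 x) _.
split => //; apply: summ_le G2 _ => x.
rewrite ger0_norm ?rsum_ge0//; apply: ler_rsum => [||y].
- exact: summ_abs.
- exact: summ_abs.
- exact: le_trans (FG x y) (ler_norm _).
Qed.

Lemma summ2_swap_ge0 (F : X -> X -> R) : (forall x y, 0 <= F x y) -> summ2 F ->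
  summ2 (fun y x => F x y) /\
  rsum (fun x => rsum (F x)) = rsum (fun y => rsum (fun x => F x y)).
Proof.
move=> F0 [F1]; under eq_fun do under eq_fun do rewrite ger0_norm//.
have r0 x : 0 <= rsum (F x) by apply: rsum_ge0.
have r0' y : 0 <= rsum (fun x => F x y) by apply: rsum_ge0.
move=> /(summ_ge0 r0) F2.
have E1 x : (rsum (F x))%:E = nsum (F x).
  by rewrite rsum_ge0E// fineK// summ_fin_num.
have E2 : nsum (fun x => rsum (F x)) = (\esum_(y in [set: X]) nsum (fun x => F x y))%E.
  by rewrite -nsum_swap//; apply: eq_esum => x _.
have F1' y : summ (fun x => F x y).
  apply/summ_ge0 => //.
  (* The column sums have a finite total, so each of them is finite. *)
  have := @summable_pinfty X R setT (fun y => nsum (fun x => F x y)).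
  move=> /(_ _ y I); rewrite gee0_abs; last exact: nsum_ge0.
  apply; rewrite /summable; under eq_esum do rewrite gee0_abs ?nsum_ge0//.
  by rewrite -E2.
have E1' y : (rsum (fun x => F x y))%:E = nsum (fun x => F x y).
  by rewrite rsum_ge0E// fineK// summ_fin_num.
have E3 : nsum (fun x => rsum (F x)) = nsum (fun y => rsum (fun x => F x y)).
  by rewrite E2; apply: eq_esum => y _.
split; last by rewrite [LHS]rsum_ge0E// E3 -rsum_ge0E.
split => //; under eq_fun do under eq_fun do rewrite ger0_norm//.
by apply/summ_ge0 => //; rewrite -E3.
Qed.

Lemma summ2_rsum (F : X -> X -> R) : summ2 F -> summ (fun x => rsum (F x)).
Proof.
move=> [F1 F2]; apply: summ_le F2 _ => x; exact: ler_norm_rsum.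
Qed.

Lemma summ2_swap (F : X -> X -> R) : summ2 F -> summ2 (fun y x => F x y).
Proof.
move=> F2; apply: (@summ2_le (fun y x => `|F x y|)) => //.
have /summ2_swap_ge0[] // : summ2 (fun x y => `|F x y|).
by case: F2 => F1 F2; split=> [x|]; [exact: summ_abs|];
  under eq_fun do under eq_fun do rewrite normr_id.
Qed.

(** Fubini, from the nonnegative case applied to the positive and negative parts of [F]. *)
Lemma rsum_swap (F : X -> X -> R) : summ2 F ->
  rsum (fun x => rsum (F x)) = rsum (fun y => rsum (fun x => F x y)).
Proof.
move=> F2.
pose P x y := Num.max (F x y) 0; pose N x y := Num.max (- F x y) 0.
have P0 x y : 0 <= P x y by rewrite le_max lexx orbT.
have N0 x y : 0 <= N x y by rewrite le_max lexx orbT.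
have aF2 : summ2 (fun x y => `|F x y|).
  by case: F2 => F1 F2; split=> [x|]; [exact: summ_abs|];
    under eq_fun do under eq_fun do rewrite normr_id.
have P2 : summ2 P.
  apply: summ2_le aF2 _ => x y; rewrite ger0_norm// ge_max normr_ge0 andbT.
  exact: ler_norm.
have N2 : summ2 N.
  apply: summ2_le aF2 _ => x y; rewrite ger0_norm// ge_max normr_ge0 andbT.
  by rewrite -normrN ler_norm.
have FE x y : F x y = P x y - N x y.
  by rewrite maxr_posneg.
have [P2' PE] := summ2_swap_ge0 P0 P2; have [N2' NE] := summ2_swap_ge0 N0 N2.
transitivity (rsum (fun x => rsum (P x)) - rsum (fun x => rsum (N x))).
  rewrite -rsumB; try (by move=> x; apply: rsum_ge0); try exact: summ2_rsum.
  apply: eq_rsum => x; rewrite -rsumB//; [|exact: P2.1|exact: N2.1].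
  by apply: eq_rsum => y.
rewrite PE NE -rsumB; try (by move=> x; apply: rsum_ge0); try exact: summ2_rsum.
apply: eq_rsum => y; rewrite -rsumB//; [|exact: P2'.1|exact: N2'.1].
by apply: eq_rsum => x; rewrite FE.
Qed.

End Sums.

(** * Weighted inner products and the graph Laplacian *)

Lemma discriminant_le (R : realFieldType) (A B C : R) : 0 <= A -> 0 <= C ->
  (forall t, 0 <= A + 2 * t * B + t ^+ 2 * C) -> B ^+ 2 <= A * C.
Proof.
move=> A0 C0 H; have [C_eq0|C_neq0] := eqVneq C 0.
  suff -> : B = 0 by rewrite expr0n mulr_ge0.
  (* With no quadratic term the expression is affine in t; at this t it equals -1. *)
  apply/eqP; apply: contraT => B0; have := H (- (A + 1) / (2 * B)).
  rewrite C_eq0 mulr0 addr0.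
  have -> : A + 2 * (- (A + 1) / (2 * B)) * B = -1 by field.
  by lra.
have {}C0 : 0 < C by rewrite lt_neqAle eq_sym C_neq0.
have := H (- B / C).
have -> : A + 2 * (- B / C) * B + (- B / C) ^+ 2 * C = (A * C - B ^+ 2) / C.
  by field.
by rewrite pmulr_lge0 ?invr_gt0// subr_ge0.
Qed.

Section L2.
Variables (R : realType) (X : countType) (w : X -> R).
Hypothesis w0 : forall x, 0 <= w x.
Implicit Types f g h : X -> R.

(** The weight is any nonnegative function: it is [m] most of the time, and a row [b x] in
    [Hop_sqr_le]. *)
Definition wip f g := rsum (fun x => f x * g x * w x).

Lemma sqr_w_ge0 f x : 0 <= f x ^+ 2 * w x.
Proof. by rewrite mulr_ge0// sqr_ge0. Qed.

Lemma l2_summ f : l2 w f <-> summ (fun x => f x ^+ 2 * w x).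
Proof. by split=> [?|/(summ_ge0 (sqr_w_ge0 f))//]; apply/(summ_ge0 (sqr_w_ge0 f)). Qed.

Lemma l2_sqr_summ f : l2 w f -> summ (fun x => f x ^+ 2 * w x).
Proof. by case: (l2_summ f). Qed.

Lemma summ_ip f g : l2 w f -> l2 w g -> summ (fun x => f x * g x * w x).
Proof.
move=> /l2_summ lf /l2_summ lg; apply: summ_le (summD lf lg) _ => x.
rewrite normrM (ger0_norm (w0 x)) -mulrDl ler_wpM2r// ler_norml.
by apply/andP; split; nra.
Qed.

Lemma l2_lin (a c : R) f g : l2 w f -> l2 w g -> l2 w (fun x => a * f x + c * g x).
Proof.
move=> /l2_summ lf /l2_summ lg; apply/l2_summ.
have := summD (summZ (2 * a ^+ 2) lf) (summZ (2 * c ^+ 2) lg).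
move/summ_le; apply => x; rewrite ger0_norm; last by rewrite mulr_ge0 ?sqr_ge0.
rewrite !mulrA -mulrDl ler_wpM2r//.
by have := sqr_ge0 (a * f x - c * g x); nra.
Qed.

Lemma ipC f g : wip f g = wip g f.
Proof. by apply: eq_rsum => x; rewrite (mulrC (f x)). Qed.

Lemma ip_linl (a c : R) f g h : l2 w f -> l2 w g -> l2 w h ->
  wip (fun x => a * f x + c * g x) h = a * wip f h + c * wip g h.
Proof.
move=> lf lg lh; have sf := summ_ip lf lh; have sg := summ_ip lg lh.
rewrite /wip -(rsumZ _ sf) -(rsumZ _ sg) -rsumD; try exact: summZ.
by apply: eq_rsum => x; ring.
Qed.

Lemma ip_linr (a c : R) f g h : l2 w f -> l2 w g -> l2 w h ->
  wip h (fun x => a * f x + c * g x) = a * wip h f + c * wip h g.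
Proof. by move=> *; rewrite ipC ip_linl// !(ipC h). Qed.

Lemma ip_sqr f : wip f f = rsum (fun x => f x ^+ 2 * w x).
Proof. by apply: eq_rsum => x; rewrite expr2. Qed.

Lemma ip_ge0 f : 0 <= wip f f.
Proof. by rewrite ip_sqr; apply: rsum_ge0; exact: sqr_w_ge0. Qed.

Lemma l2norm_sqr f : l2norm w f ^+ 2 = wip f f.
Proof.
rewrite /l2norm -rsum_ge0E; last exact: sqr_w_ge0.
by rewrite -ip_sqr sqr_sqrtr// ip_ge0.
Qed.

Lemma sqr_le_ip f x : l2 w f -> f x ^+ 2 * w x <= wip f f.
Proof.
move=> /l2_summ lf; rewrite ip_sqr.
exact: (@le_rsum1 _ _ (fun x => f x ^+ 2 * w x) x (sqr_w_ge0 f)).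
Qed.

Lemma ip_sqr_lin (a c : R) f g : l2 w f -> l2 w g ->
  wip (fun x => a * f x + c * g x) (fun x => a * f x + c * g x) =
  a ^+ 2 * wip f f + 2 * a * c * wip f g + c ^+ 2 * wip g g.
Proof.
move=> lf lg; have ll := l2_lin a c lf lg.
by rewrite ip_linl// !ip_linr// (ipC g f); ring.
Qed.

Lemma ip_CauchySchwarz f g : l2 w f -> l2 w g ->
  wip f g ^+ 2 <= wip f f * wip g g.
Proof.
move=> lf lg; apply: discriminant_le; try exact: ip_ge0.
move=> t; have := ip_ge0 (fun x => 1 * f x + t * g x).
by rewrite ip_sqr_lin// expr1n mul1r mulr1.
Qed.

End L2.

Section Laplacian.
Variables (R : realType) (X : countType) (b : X -> X -> R) (m : X -> R) (C : R).
Hypotheses (b0 : forall x y, 0 <= b x y) (bC : forall x y, b x y = b y x).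
Hypotheses (bsumm : forall x, summ (b x)) (m_gt0 : forall x, 0 < m x).
Hypotheses (C0 : 0 <= C) (degC : forall x, rsum (b x) <= C * m x).
Implicit Types f g h : X -> R.

Local Notation ip := (wip m).
Local Notation l2 := (l2 m).
Local Notation H := (Hop b m).

Let m0 x : 0 <= m x. Proof. exact: ltW. Qed.

Lemma summ2D (F G : X -> X -> R) : summ2 F -> summ2 G ->
  summ2 (fun x y => F x y + G x y).
Proof.
move=> [F1 F2] [G1 G2]; split=> [x|]; first exact: summD.
apply: summ_le (summD F2 G2) _ => x; rewrite ger0_norm ?rsum_ge0//.
rewrite -rsumD; try exact: summ_abs.
apply: ler_rsum => [||y]; [exact/summ_abs/summD| |exact: ler_normD].
by apply: summD; exact: summ_abs.
Qed.

(** Condition (B) enters here: the sum of row x is f(x)^2 times the degree of x, at most C f(x)^2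
    m(x). *)
Lemma edge_sqrl f : l2 f -> summ2 (fun x y => b x y * f x ^+ 2).
Proof.
move=> /(l2_summ m0) lf; split=> [x|].
  by under eq_fun do rewrite mulrC; exact: summZ.
apply: summ_le (summZ C lf) _ => x; rewrite ger0_norm ?rsum_ge0//.
rewrite (@eq_rsum _ _ _ (fun y => f x ^+ 2 * b x y)) => [|y]; last first.
  by rewrite ger0_norm; [rewrite mulrC|rewrite mulr_ge0 ?sqr_ge0].
by rewrite rsumZ//; have := degC x; have := sqr_ge0 (f x); nra.
Qed.

Lemma edge_sqrr f : l2 f -> summ2 (fun x y => b x y * f y ^+ 2).
Proof.
move=> /edge_sqrl /summ2_swap; congr summ2.
by apply/funext => x; apply/funext => y; rewrite bC.
Qed.

Lemma edge_sqr f : l2 f -> summ2 (fun x y => b x y * f x ^+ 2 + b x y * f y ^+ 2).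
Proof. by move=> lf; apply: summ2D; [exact: edge_sqrl|exact: edge_sqrr]. Qed.

(** A common majorant from which the double sums of Green's formula and of the energy inherit their
    summability. *)
Lemma summ2_edge f g (F : X -> X -> R) : l2 f -> l2 g ->
  (forall x y, `|F x y| <= b x y * (f x ^+ 2 + f y ^+ 2 + g x ^+ 2 + g y ^+ 2)) ->
  summ2 F.
Proof.
move=> lf lg FE; apply: summ2_le (summ2D (edge_sqr lf) (edge_sqr lg)) _ => x y.
by apply: le_trans (FE x y) _; rewrite le_eqVlt; apply/orP; left; apply/eqP; ring.
Qed.

Lemma summ2_grad f g : l2 f -> l2 g ->
  summ2 (fun x y => b x y * (f x - f y) * g x).
Proof.
move=> lf lg; apply: (summ2_edge lf lg) => x y.
rewrite -mulrA normrM (ger0_norm (b0 x y)) ler_wpM2l// ler_norml.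
have := sqr_ge0 (f x + f y); have := sqr_ge0 (g x); have := sqr_ge0 (g y).
have := sqr_ge0 (f x - f y - g x); have := sqr_ge0 (f x - f y + g x).
by move=> *; apply/andP; split; nra.
Qed.

Lemma summ_edge f x : l2 f -> summ (fun y => b x y * (f x - f y)).
Proof.
move=> lf; have [s1 _] := edge_sqr lf.
(* Uses |f(x) - f(y)| <= 1 + f(x)^2 + f(y)^2; the constant 1 is summable against b(x, .) since the
   degree is finite. *)
apply: summ_le (summD (bsumm x) (s1 x)) _ => y.
rewrite normrM (ger0_norm (b0 x y)) -mulrDr -[X in _ <= X + _]mulr1 -mulrDr.
rewrite ler_wpM2l// ler_norml.
have := sqr_ge0 (f x - 1); have := sqr_ge0 (f y - 1).
have := sqr_ge0 (f x + 1); have := sqr_ge0 (f y + 1).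
by move=> *; apply/andP; split; nra.
Qed.

Lemma Hop_mul_m f x : H f x * m x = rsum (fun y => b x y * (f x - f y)).
Proof. by rewrite /Hop mulrAC mulVf ?mul1r// gt_eqF. Qed.

Lemma Hop_lin (a c : R) f g x : l2 f -> l2 g ->
  H (fun x => a * f x + c * g x) x = a * H f x + c * H g x.
Proof.
move=> lf lg; have sf := summ_edge x lf; have sg := summ_edge x lg.
apply: (mulIf (lt0r_neq0 (m_gt0 x))); rewrite mulrDl -(mulrA a) -(mulrA c) !Hop_mul_m.
rewrite -(rsumZ _ sf) -(rsumZ _ sg) -rsumD; try exact: summZ.
by apply: eq_rsum => y; ring.
Qed.

(** Twice the form E(f, f), as the sum runs over ordered pairs; hence the factors 2 below. *)
Definition dirichlet f := rsum (fun x => rsum (fun y => b x y * (f x - f y) ^+ 2)).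

Lemma summ2_dirichlet f : l2 f -> summ2 (fun x y => b x y * (f x - f y) ^+ 2).
Proof.
move=> lf; apply: (summ2_edge lf lf) => x y.
rewrite normrM (ger0_norm (b0 x y)) ler_wpM2l// ger0_norm ?sqr_ge0//.
by have := sqr_ge0 (f x + f y); nra.
Qed.

(** Two copies of the sum for <H f, g> are added, one with x and y exchanged; by symmetry of [b] the
    exchange turns g(x) into -g(y). *)
Lemma green f g : l2 f -> l2 g ->
  2 * ip (H f) g = rsum (fun x => rsum (fun y => b x y * (f x - f y) * (g x - g y))).
Proof.
move=> lf lg; have s2 := summ2_grad lf lg.
have E : ip (H f) g = rsum (fun x => rsum (fun y => b x y * (f x - f y) * g x)).
  apply: eq_rsum => x; rewrite mulrAC Hop_mul_m mulrC -rsumZ; last exact: summ_edge.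
  by apply: eq_rsum => y; rewrite mulrC.
rewrite mulrDl mul1r {2}E rsum_swap// E -rsumD; last 2 first.
- exact: summ2_rsum.
- exact: summ2_rsum (summ2_swap s2).
apply: eq_rsum => x; rewrite -rsumD; [|exact: s2.1|exact: (summ2_swap s2).1].
by apply: eq_rsum => y; rewrite (bC y x); ring.
Qed.

Lemma ip_Hop_sym f g : l2 f -> l2 g -> ip (H f) g = ip f (H g).
Proof.
move=> lf lg; suff : 2 * ip (H f) g = 2 * ip (H g) f.
  by move=> E; rewrite (ipC m f); apply: (@mulfI _ 2).
rewrite !green//; apply: eq_rsum => x; apply: eq_rsum => y; ring.
Qed.

Lemma ip_Hop_dirichlet f : l2 f -> ip (H f) f = dirichlet f / 2.
Proof.
move=> lf; apply: (@mulfI _ 2) => //; rewrite green// mulrC divfK//.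
by apply: eq_rsum => x; apply: eq_rsum => y; rewrite expr2 mulrA.
Qed.

(** Cauchy-Schwarz for the weight b(x, .), applied to the constant 1 and to y |-> f(x) - f(y),
    followed by the degree bound. *)
Lemma Hop_sqr_le f x : l2 f ->
  H f x ^+ 2 * m x <= C * rsum (fun y => b x y * (f x - f y) ^+ 2).
Proof.
move=> lf; have D2 := (summ2_dirichlet lf).1 x.
set D := rsum _; have D0 : 0 <= D.
  by apply: rsum_ge0 => y; rewrite mulr_ge0 ?sqr_ge0.
have CS : (H f x * m x) ^+ 2 <= rsum (b x) * D.
  have l1 : Defs.l2 (b x) (fun=> 1).
    by apply/(l2_summ (b0 x)); under eq_fun do rewrite expr1n mul1r.
  have l3 : Defs.l2 (b x) (fun y => f x - f y).
    by apply/(l2_summ (b0 x)); under eq_fun do rewrite mulrC.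
  have := ip_CauchySchwarz (b0 x) l1 l3.
  rewrite /wip Hop_mul_m; congr (_ ^+ 2 <= _ * _); apply: eq_rsum => y; ring.
rewrite -(ler_pM2r (m_gt0 x)) -mulrA -expr2 -exprMn (le_trans CS)//.
by rewrite mulrAC ler_wpM2r.
Qed.

Lemma l2_Hop f : l2 f -> l2 (H f).
Proof.
move=> lf; apply/(l2_summ m0).
apply: summ_le (summZ C (summ2_rsum (summ2_dirichlet lf))) _ => x.
by rewrite ger0_norm ?Hop_sqr_le// mulr_ge0 ?sqr_ge0.
Qed.

Lemma ip_HopHop_le f : l2 f -> ip (H f) (H f) <= 2 * C * ip (H f) f.
Proof.
move=> lf; have := summ2_rsum (summ2_dirichlet lf) => s.
rewrite ip_sqr; apply: le_trans (ler_rsum _ (summZ C s) _) _.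
- exact: l2_sqr_summ (l2_Hop lf).
- by move=> x; exact: Hop_sqr_le.
- by rewrite rsumZ// ip_Hop_dirichlet// /dirichlet; lra.
Qed.

Lemma ip_Hop_ge0 f : l2 f -> 0 <= ip (H f) f.
Proof.
move=> lf; rewrite ip_Hop_dirichlet// divr_ge0//.
by apply: rsum_ge0 => x; apply: rsum_ge0 => y; rewrite mulr_ge0 ?sqr_ge0.
Qed.

(** From (f(x) - f(y))^2 <= 2 f(x)^2 + 2 f(y)^2, where each of the two resulting double sums is at
    most C |f|^2. *)
Lemma ip_Hop_le f : l2 f -> ip (H f) f <= 2 * C * ip f f.
Proof.
move=> lf; rewrite ip_Hop_dirichlet//.
have s2 := edge_sqrl lf; have s2' := edge_sqrr lf; have sD := summ2_dirichlet lf.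
have E : rsum (fun x => rsum (fun y => b x y * f x ^+ 2)) <= C * ip f f.
  rewrite ip_sqr -rsumZ; last exact: l2_sqr_summ lf.
  apply: ler_rsum => [||x]; [exact: summ2_rsum|exact: summZ (l2_sqr_summ m0 lf)|].
  under eq_rsum do rewrite mulrC.
  by rewrite rsumZ//; have := degC x; have := sqr_ge0 (f x); nra.
have E' : rsum (fun x => rsum (fun y => b x y * f y ^+ 2)) <= C * ip f f.
  rewrite rsum_swap//; apply: le_trans E; rewrite le_eqVlt; apply/orP; left.
  by apply/eqP/eq_rsum => x; apply: eq_rsum => y; rewrite bC.
suff : dirichlet f <= 2 * (rsum (fun x => rsum (fun y => b x y * f x ^+ 2)) +
    rsum (fun x => rsum (fun y => b x y * f y ^+ 2))) by lra.
rewrite -rsumD; try exact: summ2_rsum.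
have s3 : summ (fun x => rsum (fun y => b x y * f x ^+ 2) +
                         rsum (fun y => b x y * f y ^+ 2)).
  by apply: summD; exact: summ2_rsum.
rewrite -rsumZ//; apply: ler_rsum => [||x]; [exact: summ2_rsum|exact: summZ|].
rewrite -rsumD; [|exact: s2.1|exact: s2'.1].
have s4 := (edge_sqr lf).1 x.
rewrite -rsumZ//; apply: ler_rsum => [||y]; [exact: sD.1|exact: summZ|].
rewrite -mulrDr (mulrCA 2) ler_wpM2l//.
by have := sqr_ge0 (f x + f y); nra.
Qed.

Lemma ip_HopHop_bound f : l2 f -> ip (H f) (H f) <= (2 * C) ^+ 2 * ip f f.
Proof.
move=> lf; apply: le_trans (ip_HopHop_le lf) _.
by rewrite expr2 -(mulrA (2 * C) (2 * C)) ler_wpM2l ?mulr_ge0// ip_Hop_le.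
Qed.

End Laplacian.

(** * Path estimate *)

Section Paths.
Variables (R : realType) (X : countType) (b : X -> X -> R).
Hypothesis b0 : forall x y, 0 <= b x y.
Implicit Types (f : X -> R) (x y : X) (p q : seq X).

Lemma plength_ge0 x p : 0 <= plength b x p.
Proof. by elim: p x => //= y p IH x; rewrite addr_ge0// invr_ge0. Qed.

(** The path is cut at the vertex x: what follows is still simple and no longer than the whole. This
    is the loop removal of [simple_gpath]. *)
Lemma gpath_suffix x y q : is_gpath b y q -> uniq (y :: q) -> x \in y :: q ->
  exists p, [/\ is_gpath b x p, last x p = last y q, uniq (x :: p) &
                plength b x p <= plength b y q].
Proof.
elim: q y => [|z q IH] y /=; first by rewrite mem_seq1 => _ _ /eqP ->; exists [::].
move=> /andP[byz pz] /andP[yzq uzq]; rewrite inE => /orP[/eqP ->|xzq].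
  by exists (z :: q); split => //=; [rewrite byz|rewrite yzq].
have [p [? ? ? lp]] := IH z pz uzq xzq; exists p; split => //.
by apply: le_trans lp _; rewrite lerDr invr_ge0.
Qed.

(** By induction the tail is made simple; if x occurs on it, the part of the tail from x on replaces
    the path. *)
Lemma simple_gpath x p : is_gpath b x p ->
  exists q, [/\ is_gpath b x q, last x q = last x p, uniq (x :: q) &
                plength b x q <= plength b x p].
Proof.
elim: p x => [|y p IH] x /=; first by exists [::].
move=> /andP[bxy /IH[q [pq lq uq leq]]].
have [xyq|xyq] := boolP (x \in y :: q).
  have [p' [? lp' ? lep]] := gpath_suffix pq uq xyq.
  exists p'; split => //; first by rewrite lp'.
  by apply: le_trans lep (le_trans leq _); rewrite lerDr invr_ge0.
exists (y :: q); split => //=; first by rewrite bxy.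
  by rewrite xyq.
by rewrite lerD2l.
Qed.

Fixpoint penergy f x p : R :=
  if p is y :: q then b x y * (f x - f y) ^+ 2 + penergy f y q else 0.

Lemma penergy_ge0 f x p : 0 <= penergy f x p.
Proof.
by elim: p x => //= y p IH x; rewrite addr_ge0// mulr_ge0// sqr_ge0.
Qed.

(** One step of Cauchy-Schwarz along a path: an edge of weight B and increment a is put in front of
    a path of length L, energy S and increment c. *)
Lemma sqrD_le (B L S a c : R) : 0 < B -> 0 <= L -> 0 <= S -> c ^+ 2 <= L * S ->
  (a + c) ^+ 2 <= (B^-1 + L) * (B * a ^+ 2 + S).
Proof.
move=> B0 L0 S0 cLS.
have -> : (B^-1 + L) * (B * a ^+ 2 + S) = a ^+ 2 + (S / B + L * (B * a ^+ 2)) + L * S.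
  by field; rewrite gt_eqF.
suff : 2 * a * c <= S / B + L * (B * a ^+ 2) by nra.
have T0 : 0 <= S / B + L * (B * a ^+ 2).
  have B1 := ltW B0; apply: addr_ge0; first exact: divr_ge0.
  by apply: mulr_ge0 => //; apply: mulr_ge0 => //; exact: sqr_ge0.
(* Arithmetic-geometric mean inequality for S / B and L B a^2, whose product is a^2 L S. *)
have : (2 * a * c) ^+ 2 <= (S / B + L * (B * a ^+ 2)) ^+ 2.
  have -> : (S / B + L * (B * a ^+ 2)) ^+ 2 =
    (S / B - L * (B * a ^+ 2)) ^+ 2 + 4 * a ^+ 2 * (L * S).
    by field; rewrite gt_eqF.
  by have := sqr_ge0 (S / B - L * (B * a ^+ 2)); have := sqr_ge0 a; nra.
move=> h; have [//|lt] := leP (2 * a * c) (S / B + L * (B * a ^+ 2)).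
by nra.
Qed.

Lemma path_penergy f x p : is_gpath b x p ->
  (f x - f (last x p)) ^+ 2 <= plength b x p * penergy f x p.
Proof.
elim: p x => [|y p IH] x /=; first by rewrite subrr expr0n mulr0.
move=> /andP[bxy /IH{}IH].
have -> : f x - f (last y p) = (f x - f y) + (f y - f (last y p)) by ring.
by apply: sqrD_le => //; [exact: plength_ge0|exact: penergy_ge0].
Qed.

(* Stated on vertices: the double sum counts each edge twice, and the vertices of
   a simple path are distinct. *)
Lemma penergy_le f x p : (forall x y, b x y = b y x) ->
  2 * penergy f x p <=
  \sum_(u <- x :: p) \sum_(v <- x :: p) b u v * (f u - f v) ^+ 2.
Proof.
move=> bC; set G := fun u v => b u v * (f u - f v) ^+ 2.
have G0 u v : 0 <= G u v by rewrite mulr_ge0// sqr_ge0.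
have GC u v : G u v = G v u by rewrite /G bC; congr (_ * _); ring.
elim: p x => [|y p IH] x /=; first by rewrite mulr0 !big_seq1 G0.
rewrite big_cons [\sum_(v <- x :: _) G x v]big_cons.
rewrite [X in _ <= _ + X](eq_bigr (fun u => G x u + \sum_(v <- y :: p) G u v));
  last by move=> u _; rewrite big_cons -/(G u x) GC.
rewrite big_split /=.
have xy : G x y <= \sum_(v <- y :: p) G x v.
  by rewrite big_cons lerDl sumr_ge0.
by have := IH y; have := G0 x x; rewrite -/(G x y); lra.
Qed.

(** Connectedness makes the set of path lengths nonempty, so that [inf] is a true infimum and can be
    approached. *)
Lemma gdist_lt x y r : connected_graph b -> gdist b x y < r ->
  exists p, [/\ is_gpath b x p, last x p = y & plength b x p < r].
Proof.
move=> conn /inf_lt[].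
  by have [p pP] := conn x y; exists (plength b x p), p.
by move=> _ [p [pp lp] <-] pr; exists p.
Qed.

Lemma fine_inradius_ge0 (Om : set X) : 0 <= fine (inradius b Om).
Proof.
rewrite /inradius; set S := [set _ | _ in _].
(* Without admissible radii the supremum is -oo, which [fine] sends to 0. *)
have [S0|SN0] := pselect (S = set0); first by rewrite S0 ereal_sup0.
have [e [r [r0 rP] _]] : S !=set0 by apply/set0P/eqP.
apply: fine_ge0; apply: (@le_trans _ _ r%:E); first by rewrite lee_fin ltW.
by apply: ereal_sup_ubound; exists r.
Qed.

(** If no point at distance less than r from x were outside [Om], then r would be an admissible
    radius and could not exceed the inradius. *)
Lemma exit_path (Om : set X) x r : connected_graph b -> (inradius b Om < +oo)%E ->
  Om x -> fine (inradius b Om) < r ->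
  exists p, [/\ is_gpath b x p, ~ Om (last x p) & plength b x p < r].
Proof.
move=> conn Ioo Ox Ir; have r0 : 0 < r := le_lt_trans (fine_inradius_ge0 Om) Ir.
have [[y [yr nOy]]|nex] := pselect (exists y, gdist b x y < r /\ ~ Om y).
  by have [p [? E ?]] := gdist_lt conn yr; exists p; rewrite E.
have : (r%:E <= inradius b Om)%E.
  apply: ereal_sup_ubound; exists r => //; split => //; exists x; split=> // y yr.
  by apply: contrapT => nOy; apply: nex; exists y.
by move: Ioo Ir; case: (inradius b Om) => [i| |]//= _; rewrite lee_fin; lra.
Qed.

End Paths.

(** * Faber-Krahn inequality in terms of inradius and volume *)

Section LowerBound.
Variables (R : realType) (X : countType) (b : X -> X -> R) (m : X -> R) (C : R).
Hypotheses (b0 : forall x y, 0 <= b x y) (bC : forall x y, b x y = b y x).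
Hypotheses (bsumm : forall x, summ (b x)) (m_gt0 : forall x, 0 < m x).
Hypothesis degC : forall x, rsum (b x) <= C * m x.
Variable Om : set X.
Hypotheses (conn : connected_graph b) (Ioo : (inradius b Om < +oo)%E).
Hypothesis voloo : (vol m Om < +oo)%E.
Implicit Types f g h : X -> R.

Local Notation ip := (wip m).
Local Notation H := (Hop b m).

Definition l2D f := l2 m f /\ forall x, ~ Om x -> f x = 0.

Let m0 x : 0 <= m x. Proof. exact: ltW. Qed.

(** After loop removal the vertices are distinct, so twice the energy of the path is bounded by a
    finite part of the double sum [dirichlet f]. *)
Lemma path_dirichlet f x p : l2 m f -> is_gpath b x p ->
  (f x - f (last x p)) ^+ 2 <= plength b x p * ip (H f) f.
Proof.
move=> lf /(simple_gpath b0)[q [pq <- uq leq]].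
apply: le_trans (path_penergy b0 f pq) _.
apply: ler_pM leq _; [exact: plength_ge0|exact: penergy_ge0|].
rewrite (ip_Hop_dirichlet b0 bC bsumm m_gt0 degC lf) ler_pdivlMr// mulrC.
apply: le_trans (penergy_le b0 f x q bC) _.
have [s1 _] := summ2_dirichlet b0 bC bsumm m_gt0 degC lf.
have s2 := summ2_rsum (summ2_dirichlet b0 bC bsumm m_gt0 degC lf).
have G0 u v : 0 <= b u v * (f u - f v) ^+ 2 by rewrite mulr_ge0// sqr_ge0.
apply: le_trans (sum_le_rsum _ s2 uq); last by move=> u; exact: rsum_ge0.
by apply: ler_sum => u _; exact: sum_le_rsum.
Qed.

Lemma sqr_le_inradius f x : l2D f ->
  f x ^+ 2 <= fine (inradius b Om) * ip (H f) f.
Proof.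
move=> [lf f0]; set I := fine _.
have I0 : 0 <= I by exact: fine_inradius_ge0.
have E0 : 0 <= ip (H f) f by exact: (ip_Hop_ge0 b0 bC bsumm m_gt0 degC lf).
have [Ox|nOx] := pselect (Om x); last by rewrite f0// expr0n mulr_ge0.
have key r : I < r -> f x ^+ 2 <= r * ip (H f) f.
  move=> Ir; have [p [pp nO pr]] := exit_path conn Ioo Ox Ir.
  have := path_dirichlet lf pp; rewrite (f0 _ nO) subr0 => /le_trans; apply.
  by rewrite ler_wpM2r// ltW.
apply/ler_addgt0Pr => e e0; set E := ip _ _ in E0 key *.
have E1 : 0 < E + 1 by rewrite ltr_wpDl.
(* The bound holds for each r above the inradius; this r costs at most e, and E + 1 is positive even
   when the energy E vanishes. *)
apply: le_trans (key (I + e / (E + 1)) _) _; first by rewrite ltrDl divr_gt0.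
rewrite mulrDl lerD2l -mulrA ger_pMr// mulrC ler_pdivrMr// mul1r; lra.
Qed.

(** Extension of [m] by zero off [Om], turning sums over [Om] into sums over X. *)
Definition mOm x := if `[< Om x >] then m x else 0.

Lemma mOm_ge0 x : 0 <= mOm x.
Proof. by rewrite /mOm; case: ifP. Qed.

Lemma vol_nsum : vol m Om = nsum mOm.
Proof.
rewrite /vol esum_mkcond; apply: eq_esum => x _; rewrite /mOm.
case: asboolP => Ox; first by rewrite mem_set.
by rewrite memNset.
Qed.

Lemma summ_mOm : summ mOm.
Proof. by apply/(summ_ge0 mOm_ge0); rewrite -vol_nsum. Qed.

Lemma rsum_mOm : rsum mOm = fine (vol m Om).
Proof. by rewrite rsum_ge0E ?vol_nsum//; exact: mOm_ge0. Qed.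

Lemma faber_krahn f : l2D f ->
  ip f f <= fine (inradius b Om) * fine (vol m Om) * ip (H f) f.
Proof.
move=> Df; rewrite mulrAC -rsum_mOm -rsumZ; last exact: summ_mOm.
rewrite ip_sqr; apply: ler_rsum => [||x].
- by apply: l2_sqr_summ => //; case: Df.
- exact: summZ summ_mOm.
rewrite /mOm; case: asboolP => Ox; first by rewrite ler_wpM2r// sqr_le_inradius.
by case: Df => _ ->//; rewrite expr0n mul0r mulr0.
Qed.

End LowerBound.

(** * Completeness *)

(** A Bernoulli-type bound n (1 - q) q^n <= 1 - q^n gives x n (1 - q) <= B for all n if x > 0,
    against the Archimedean property. It replaces passages to the limit below. *)
Lemma geometric_le0 (R : archiRealFieldType) (q B x : R) : 0 <= q -> q < 1 -> 0 <= B ->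
  (forall n, x <= B * q ^+ n) -> x <= 0.
Proof.
move=> q0 q1 B0 xB; have qn n : 0 <= q ^+ n <= 1.
  by rewrite exprn_ge0//= exprn_ile1// ltW.
have bern n : n%:R * (1 - q) * q ^+ n <= 1 - q ^+ n.
  elim: n => [|n IH]; first by rewrite !mul0r expr0 subrr.
  rewrite -natr1; have /andP[_ h] := qn n.+1; rewrite exprS in h *.
  have : 0 <= (1 - q) * (1 - q * q ^+ n) by rewrite mulr_ge0 ?subr_ge0// ltW.
  by have := ler_wpM2l q0 IH; lra.
have [//|x0] := leP x 0.
have xn n : x * (n%:R * (1 - q)) <= B.
  have n0 : 0 <= n%:R * (1 - q) by rewrite mulr_ge0// subr_ge0 ltW.
  apply: le_trans (ler_wpM2r n0 (xB n)) _.
  rewrite -mulrA mulrC -{2}[B]mul1r ler_wpM2r// mulrC.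
  by apply: le_trans (bern n) _; have /andP[] := qn n; lra.
have d0 : 0 < x * (1 - q) by rewrite mulr_gt0// subr_gt0.
have := archi_boundP (divr_ge0 B0 (ltW d0)); rewrite ltr_pdivrMr//.
by have := xn (Num.bound (B / (x * (1 - q)))); lra.
Qed.

Section Complete.
Variables (R : realType) (X : countType) (m : X -> R).
Hypothesis m_gt0 : forall x, 0 < m x.
Implicit Types f g h : X -> R.
Local Notation ip := (wip m).
Let m0 x : 0 <= m x. Proof. exact: ltW. Qed.

(** The intervals [u n - c n, u n + c n] meet pairwise, so the supremum of their left endpoints lies
    in all of them. *)
Lemma seq_limit (u c : nat -> R) : (forall n k, `|u (n + k)%N - u n| <= c n) ->
  exists v, forall n, `|v - u n| <= c n.
Proof.
move=> uc; have c0 n : 0 <= c n by apply: le_trans (uc n 0%N).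
have cross n k : u n - c n <= u k + c k.
  have [nk|/ltnW kn] := leqP n k.
    have := uc n (k - n)%N; rewrite subnKC// ler_norml => /andP[].
    by have := c0 k; lra.
  have := uc k (n - k)%N; rewrite subnKC// ler_norml => /andP[].
  by have := c0 n; lra.
pose S := range (fun n => u n - c n).
have hS : has_sup S.
  split; first by exists (u 0%N - c 0%N), 0%N.
  by exists (u 0%N + c 0%N) => _ [n _ <-].
exists (sup S) => n; rewrite ler_norml; apply/andP; split.
  have : u n - c n <= sup S by apply: ub_le_sup; [exact: hS.2|exists n].
  by lra.
have : sup S <= u n + c n by apply: ge_sup; [exact: hS.1|move=> _ [k _ <-]].
by lra.
Qed.

(** Pointwise limits exist because one term of a squared norm is at most the whole; the norm bound
    follows on finite sets. The second clause keeps the limit zero wherever all terms of the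
    sequence are. *)
Lemma l2_complete (u : nat -> X -> R) (q B : R) : 0 <= q -> q < 1 -> 0 <= B ->
  (forall n, l2 m (u n)) ->
  (forall n k, let d x := 1 * u (n + k)%N x + (-1) * u n x in ip d d <= B * q ^+ n) ->
  exists v, [/\ l2 m v, forall x, (forall n, u n x = 0) -> v x = 0 &
    forall n, let d x := 1 * v x + (-1) * u n x in ip d d <= 2 * B * q ^+ n].
Proof.
move=> q0 q1 B0 lu ud.
have Bq n : 0 <= B * q ^+ n by rewrite mulr_ge0// exprn_ge0.
pose c x n := Num.sqrt (B * q ^+ n / m x).
have c2 x n : c x n ^+ 2 * m x = B * q ^+ n.
  by rewrite sqr_sqrtr ?divr_ge0// divfK// gt_eqF.
have uc x n k : `|u (n + k)%N x - u n x| <= c x n.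
  rewrite -(ler_pXn2r (n := 2))// ?nnegrE ?sqrtr_ge0// -(ler_pM2r (m_gt0 x)) c2.
  apply: le_trans (ud n k); rewrite real_normK ?num_real//.
  have := sqr_le_ip m0 x (l2_lin m0 1 (-1) (lu (n + k)%N) (lu n)).
  by rewrite mul1r mulN1r.
have /choice[v vP] x := seq_limit (uc x).
have v1 x n : (v x - u n x) ^+ 2 * m x <= B * q ^+ n.
  rewrite -(c2 x) ler_wpM2r// -[leLHS]real_normK ?num_real//.
  by rewrite ler_pXn2r ?nnegrE ?sqrtr_ge0.
pose d n x := 1 * v x + (-1) * u n x.
(* Fatou on a finite set: v - u n is split at u (n + k), whence the factor 2, and the part v - u (n
   + k) disappears as k grows. *)
have fatou n (s : seq X) : uniq s -> \sum_(x <- s) d n x ^+ 2 * m x <= 2 * B * q ^+ n.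
  move=> us; rewrite -subr_le0.
  have K0 : 0 <= 2 * (size s)%:R * B * q ^+ n by rewrite !mulr_ge0// exprn_ge0.
  apply: (geometric_le0 q0 q1 K0) => k.
  rewrite lerBlDr.
  pose e x := 1 * u (n + k)%N x + (-1) * u n x.
  have le : l2 m e by exact: l2_lin.
  have E1 : \sum_(x <- s) e x ^+ 2 * m x <= B * q ^+ n.
    apply: le_trans (ud n k); rewrite ip_sqr.
    exact: sum_le_rsum (sqr_w_ge0 m0 e) (l2_sqr_summ m0 le) us.
  have E2 : \sum_(x <- s) (v x - u (n + k)%N x) ^+ 2 * m x <=
            (size s)%:R * (B * q ^+ (n + k)).
    rewrite mulr_natl -iter_addr_0 -[size s]count_predT -big_const_seq.
    by apply: ler_sum => x _; exact: v1.
  have E3 : \sum_(x <- s) d n x ^+ 2 * m x <=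
    2 * (\sum_(x <- s) e x ^+ 2 * m x) +
    2 * (\sum_(x <- s) (v x - u (n + k)%N x) ^+ 2 * m x).
    rewrite !mulr_sumr -big_split /=; apply: ler_sum => x _.
    rewrite !mulrA -mulrDl ler_wpM2r// /d /e.
    by have := sqr_ge0 (u (n + k)%N x - u n x - (v x - u (n + k)%N x)); nra.
  by move: E1 E2 E3; rewrite exprD; lra.
have ld n : l2 m (d n).
  apply/(l2_summ m0); apply: (@summ_bounded _ _ _ (2 * B * q ^+ n)) => s us.
  apply: le_trans (fatou n s us); apply: ler_sum => x _.
  by rewrite ger0_norm ?sqr_w_ge0.
exists v; split.
- have := l2_lin m0 1 1 (ld 0%N) (lu 0%N); congr l2.
  by apply/funext => x; rewrite /d; ring.
- move=> x u0; have : (v x) ^+ 2 * m x <= 0.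
    apply: (geometric_le0 q0 q1 B0) => n; have := v1 x n.
    by rewrite u0 subr0.
  rewrite pmulr_lle0// => v2; apply/eqP; rewrite -sqrf_eq0; apply/eqP.
  by apply/le_anti; rewrite v2 sqr_ge0.
- move=> n /=; rewrite ip_sqr; apply: rsum_le => [x|s us].
    exact: (sqr_w_ge0 m0 (d n)).
  exact: (fatou n s us).
Qed.

End Complete.

(** * Resolvent of the Dirichlet Laplacian *)

Section DirichletLaplacian.
Variables (R : realType) (X : countType) (b : X -> X -> R) (m : X -> R) (C : R).
Hypotheses (b0 : forall x y, 0 <= b x y) (bC : forall x y, b x y = b y x).
Hypotheses (bsumm : forall x, summ (b x)) (m_gt0 : forall x, 0 < m x).
Hypotheses (C0 : 0 <= C) (degC : forall x, rsum (b x) <= C * m x).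
Variable Om : set X.
Implicit Types f g h : X -> R.
Implicit Types u v w : cfun R X.

Local Notation ip := (wip m).
Local Notation H := (Hop b m).
Local Notation HO := (HDir b m Om).
Local Notation l2D := (l2D m Om).
Local Notation l2C := (l2C m Om).

Let m0 x : 0 <= m x. Proof. exact: ltW. Qed.

Lemma l2D_lin (a c : R) f g : l2D f -> l2D g -> l2D (fun x => a * f x + c * g x).
Proof.
move=> [lf f0] [lg g0]; split; first exact: l2_lin.
by move=> x nO; rewrite f0// g0// !mulr0 addr0.
Qed.

Lemma HDir_sqr_le f x : HO f x ^+ 2 * m x <= H f x ^+ 2 * m x.
Proof.
rewrite /HDir; case: asboolP => // _.
by rewrite expr0n mul0r mulr_ge0// sqr_ge0.
Qed.

Lemma l2D_HDir f : l2D f -> l2D (HO f).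
Proof.
move=> [lf _]; have lH := l2_Hop b0 bC bsumm m_gt0 degC lf; split.
  apply/(l2_summ m0); apply: summ_le (l2_sqr_summ m0 lH) _ => x.
  by rewrite ger0_norm ?HDir_sqr_le// mulr_ge0 ?sqr_ge0.
by move=> x nO; rewrite /HDir asboolF.
Qed.

Lemma HDir_lin (a c : R) f g x : l2D f -> l2D g ->
  HO (fun x => a * f x + c * g x) x = a * HO f x + c * HO g x.
Proof.
move=> [lf _] [lg _]; rewrite /HDir; case: asboolP => _; last by rewrite !mulr0 addr0.
exact: Hop_lin.
Qed.

(** Truncation to [Om] is not seen by functions vanishing off [Om], so [HDir] does represent the
    restricted form. *)
Lemma ip_HDir f g : l2D g -> ip (HO f) g = ip (H f) g.
Proof.
move=> [_ g0]; apply: eq_rsum => x; rewrite /HDir; case: asboolP => // nO.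
by rewrite g0// !mulr0.
Qed.

Lemma ip_HDir_bound f : l2D f -> ip (HO f) (HO f) <= (2 * C) ^+ 2 * ip f f.
Proof.
move=> Df; have lH := l2_Hop b0 bC bsumm m_gt0 degC Df.1.
apply: le_trans (ip_HopHop_bound b0 bC bsumm m_gt0 C0 degC Df.1).
rewrite !ip_sqr; apply: ler_rsum; [|exact: l2_sqr_summ|exact: HDir_sqr_le].
exact: (l2_sqr_summ m0 (l2D_HDir Df).1).
Qed.

Definition lin2 (a : R) u (c : R) v : cfun R X :=
  (fun x => a * u.1 x + c * v.1 x, fun x => a * u.2 x + c * v.2 x).

(** The real part of the complex inner product; with real scalars in [lin2], it is all that
    coercivity and norms require. *)
Definition ip2 u v := ip u.1 v.1 + ip u.2 v.2.

Lemma l2CP u : l2C u <-> l2D u.1 /\ l2D u.2.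
Proof.
split; first by move=> [l1 [l2 h]]; split; split=> // x /h[].
by move=> [[l1 h1] [l2 h2]]; split=> //; split=> // x nO; rewrite h1 ?h2.
Qed.

Lemma l2C_lin2 (a c : R) u v : l2C u -> l2C v -> l2C (lin2 a u c v).
Proof.
by move=> /l2CP[u1 u2] /l2CP[v1 v2]; apply/l2CP; split; exact: l2D_lin.
Qed.

Lemma ip2_ge0 u : 0 <= ip2 u u.
Proof. by rewrite addr_ge0// ip_ge0. Qed.

Lemma l2Cnorm_sqr u : l2Cnorm m u ^+ 2 = ip2 u u.
Proof.
by rewrite sqr_sqrtr !l2norm_sqr// ip2_ge0.
Qed.

Lemma l2Cnorm_ge0 u : 0 <= l2Cnorm m u.
Proof. exact: sqrtr_ge0. Qed.

Lemma ip2_lin2 (a c : R) u v : l2C u -> l2C v ->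
  ip2 (lin2 a u c v) (lin2 a u c v) =
  a ^+ 2 * ip2 u u + 2 * a * c * ip2 u v + c ^+ 2 * ip2 v v.
Proof.
move=> /l2CP[[u1 _] [u2 _]] /l2CP[[v1 _] [v2 _]].
by rewrite /ip2 /= !ip_sqr_lin//; ring.
Qed.

Lemma lin2_00 u v : lin2 0 u 0 v = (fun=> 0, fun=> 0).
Proof. by congr pair; apply/funext => x; rewrite !mul0r addr0. Qed.

Lemma ip2_lin2_le (a c : R) u v : l2C u -> l2C v ->
  ip2 (lin2 a u c v) (lin2 a u c v) <= 2 * a ^+ 2 * ip2 u u + 2 * c ^+ 2 * ip2 v v.
Proof.
move=> lu lv; have := ip2_ge0 (lin2 a u (- c) v).
by rewrite !ip2_lin2//; lra.
Qed.

Lemma ip2_eq0 u : l2C u -> ip2 u u <= 0 -> u = (fun=> 0, fun=> 0).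
Proof.
move=> /l2CP[[u1 _] [u2 _]] le0.
have z f x : l2 m f -> ip f f <= 0 -> f x = 0.
  move=> lf f0; have := le_trans (sqr_le_ip m0 x lf) f0; rewrite pmulr_lle0// => fx.
  by apply/eqP; rewrite -sqrf_eq0 eq_le fx sqr_ge0.
move: le0; rewrite /ip2; have := ip_ge0 m0 u.1; have := ip_ge0 m0 u.2 => h2 h1 h.
case: u u1 u2 h1 h2 h => f g /= lf lg h1 h2 h.
by congr pair; apply/funext => x; apply: z => //; lra.
Qed.

(** * Invertibility of [H_Om - z] when the real part of z is below a coercivity constant *)

Section Shift.
Variable z : R * R.
Local Notation T := (HDir_shift b m Om z).

(** The last summand is multiplication of u by -i [z.2]. *)
Lemma HDir_shift_lin2 u : T u =
  lin2 1 (lin2 1 (HO u.1, HO u.2) (- z.1) u)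
       1 (fun x => z.2 * u.2 x, fun x => - z.2 * u.1 x).
Proof.
by rewrite /HDir_shift /lin2; congr pair; apply/funext => x /=; ring.
Qed.

Lemma l2C_swap (a c : R) u : l2C u -> l2C (fun x => a * u.2 x, fun x => c * u.1 x).
Proof.
move=> /l2CP[u1 u2]; apply/l2CP; split=> /=.
  have := l2D_lin a 0 u2 u2; congr l2D.
  by apply/funext => x; rewrite mul0r addr0.
have := l2D_lin c 0 u1 u1; congr l2D.
by apply/funext => x; rewrite mul0r addr0.
Qed.

Lemma l2C_shift u : l2C u -> l2C (T u).
Proof.
move=> lu; have /l2CP[u1 u2] := lu; rewrite HDir_shift_lin2.
apply: l2C_lin2; last exact: l2C_swap.
by apply: l2C_lin2 => //; apply/l2CP; split; exact: l2D_HDir.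
Qed.

Lemma shift_lin2 (a c : R) u v : l2C u -> l2C v ->
  T (lin2 a u c v) = lin2 a (T u) c (T v).
Proof.
move=> /l2CP[u1 u2] /l2CP[v1 v2]; rewrite /HDir_shift.
by congr pair; apply/funext => x; rewrite /= HDir_lin//; ring.
Qed.

Lemma ip2_shift_bound : exists2 M : R, 0 < M & forall u, l2C u ->
  ip2 (T u) (T u) <= M * ip2 u u.
Proof.
(* Two uses of |a + b|^2 <= 2 |a|^2 + 2 |b|^2; the final 1 makes the constant positive. *)
exists (4 * (2 * C) ^+ 2 + 4 * z.1 ^+ 2 + 2 * z.2 ^+ 2 + 1) => [|u lu].
  by have := sqr_ge0 (2 * C); have := sqr_ge0 z.1; have := sqr_ge0 z.2; lra.
have /l2CP[u1 u2] := lu.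
have lH : l2C (HO u.1, HO u.2) by apply/l2CP; split; exact: l2D_HDir.
have l1 := l2C_lin2 1 (- z.1) lH lu.
have l2 := l2C_swap z.2 (- z.2) lu.
have b1 := ip_HDir_bound u1; have b2 := ip_HDir_bound u2.
rewrite HDir_shift_lin2; apply: le_trans (ip2_lin2_le _ _ l1 l2) _.
have := ip2_lin2_le 1 (- z.1) lH lu.
have -> : ip2 (fun x => z.2 * u.2 x, fun x => - z.2 * u.1 x)
              (fun x => z.2 * u.2 x, fun x => - z.2 * u.1 x) = z.2 ^+ 2 * ip2 u u.
  have sc (a : R) f : l2D f -> ip (fun x => a * f x) (fun x => a * f x) = a ^+ 2 * ip f f.
    move=> [lf _]; have := ip_sqr_lin m0 a 0 lf lf.
    rewrite [X in ip X X](_ : _ = fun x => a * f x); first by move=> ->; ring.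
    by apply/funext => x; rewrite mul0r addr0.
  by rewrite /ip2 /= !sc//; ring.
rewrite [ip2 (HO _, HO _) _]/ip2 /=.
have := ip_ge0 m0 u.1; have := ip_ge0 m0 u.2; rewrite /ip2; nra.
Qed.

Variable lam : R.
Hypotheses (coercive : forall f, l2D f -> lam * ip f f <= ip (H f) f).
Hypothesis zlam : z.1 < lam.

(** The imaginary part of z contributes [z.2] (<u.2, u.1> - <u.1, u.2>), which is zero. *)
Lemma shift_coercive u : l2C u -> (lam - z.1) * ip2 u u <= ip2 (T u) u.
Proof.
move=> /l2CP[u1 u2]; have l1 := l2D_HDir u1; have l2 := l2D_HDir u2.
have k (c : R) f g : l2D f -> l2D g ->
    ip (fun x => 1 * (1 * HO f x + - z.1 * f x) + c * g x) f =
    ip (H f) f - z.1 * ip f f + c * ip g f.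
  move=> Df Dg; have DH := l2D_HDir Df; have DL := l2D_lin 1 (- z.1) DH Df.
  rewrite (@ip_linl _ _ _ m0 1 c (fun x => 1 * HO f x + - z.1 * f x) g f DL.1 Dg.1 Df.1).
  by rewrite (ip_linl m0 _ _ DH.1 Df.1 Df.1) ip_HDir//; ring.
have E1 : (T u).1 = fun x => 1 * (1 * HO u.1 x + - z.1 * u.1 x) + z.2 * u.2 x.
  by apply/funext => x; rewrite /HDir_shift /=; ring.
have E2 : (T u).2 = fun x => 1 * (1 * HO u.2 x + - z.1 * u.2 x) + - z.2 * u.1 x.
  by apply/funext => x; rewrite /HDir_shift /=; ring.
rewrite /ip2 E1 E2 !k// (ipC m u.1 u.2).
by move: (coercive u1) (coercive u2) => {E1 E2}; lra.
Qed.

Let eps := lam - z.1.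
Let eps0 : 0 < eps. Proof. by rewrite subr_gt0. Qed.

(** Expand 0 <= |T u - eps u|^2 and insert coercivity for the mixed term. *)
Lemma shift_lower u : l2C u -> eps ^+ 2 * ip2 u u <= ip2 (T u) (T u).
Proof.
move=> lu; have lT := l2C_shift lu; have := ip2_ge0 (lin2 1 (T u) (- eps) u).
rewrite ip2_lin2//; have := ler_wpM2l (ltW eps0) (shift_coercive lu).
by rewrite -/eps; lra.
Qed.

Lemma shift_inj u v : l2C u -> l2C v -> T u = T v -> u = v.
Proof.
move=> lu lv Tuv; have ld := l2C_lin2 1 (-1) lu lv.
have /(ip2_eq0 ld) : ip2 (lin2 1 u (-1) v) (lin2 1 u (-1) v) <= 0.
  rewrite -(pmulr_rle0 _ (exprn_gt0 2 eps0)); apply: le_trans (shift_lower ld) _.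
  have lT := l2C_shift lv; rewrite shift_lin2// Tuv ip2_lin2//.
  by clear Tuv; lra.
case: u v {lu lv Tuv ld} => [u1 u2] [v1 v2]; rewrite /lin2 /= => -[/funeqP E1 /funeqP E2].
by congr pair; apply/funext => x; [have := E1 x|have := E2 x]; rewrite /=; lra.
Qed.

(** If |T u|^2 <= M |u|^2, then |u - t T u|^2 <= (1 - 2 t eps + t^2 M) |u|^2; the choice t = eps / M
    minimises the factor, with value 1 - eps^2 / M. *)
Lemma shift_contraction : exists t q : R, [/\ 0 < t, 0 <= q, q < 1 &
  forall u, l2C u ->
    ip2 (lin2 1 u (- t) (T u)) (lin2 1 u (- t) (T u)) <= q * ip2 u u].
Proof.
(* Enlarging the bound by eps^2 ensures that the contraction factor is not negative. *)
have [M0 M0p MP] := ip2_shift_bound; pose M := M0 + eps ^+ 2.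
have e2 : 0 < eps ^+ 2 by rewrite exprn_gt0.
have Mp : 0 < M by rewrite addr_gt0.
exists (eps / M), (1 - eps ^+ 2 / M); split.
- by rewrite divr_gt0.
- by rewrite subr_ge0 ler_pdivrMr// mul1r lerDr ltW.
- by rewrite ltrBlDr ltrDl divr_gt0.
move=> u lu; have lT := l2C_shift lu; rewrite ip2_lin2//.
have := shift_coercive lu; rewrite -/eps => h1.
have h2 : ip2 (T u) (T u) <= M * ip2 u u.
  by apply: le_trans (MP u lu) _; rewrite ler_wpM2r ?ip2_ge0// lerDl ltW.
have -> : ip2 u (T u) = ip2 (T u) u by rewrite /ip2 !(ipC m u.1, ipC m u.2).
have h1' := ler_wpM2l (ltW (divr_gt0 eps0 Mp)) h1.
have h2' := ler_wpM2l (ltW (exprn_gt0 2 (divr_gt0 eps0 Mp))) h2.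
have E1 : eps / M * (eps * ip2 u u) = eps ^+ 2 / M * ip2 u u by ring.
have E2 : (eps / M) ^+ 2 * (M * ip2 u u) = eps ^+ 2 / M * ip2 u u.
  by field; rewrite gt_eqF.
by rewrite E1 in h1'; rewrite E2 in h2'; rewrite sqrrN; lra.
Qed.

Lemma shift_surj w : l2C w -> exists2 u, l2C u & T u = w.
Proof.
move=> lw; have [t [q [t0 q0 q1 contr]]] := shift_contraction.
pose Rr u := lin2 1 u (- t) (T u).
have lR u : l2C u -> l2C (Rr u) by move=> lu; exact: l2C_lin2 lu (l2C_shift lu).
(* Richardson iteration for [T u = w]; the differences are contracted. *)
pose it := fix it n : cfun R X :=
  if n is k.+1 then lin2 1 (Rr (it k)) t w else (fun=> 0, fun=> 0).
have lz : l2C (fun=> 0, fun=> 0).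
  by rewrite -(lin2_00 w w); exact: l2C_lin2.
have lit n : l2C (it n) by elim: n => //= n IH; apply: l2C_lin2 => //; exact: lR.
pose dif n k := lin2 1 (it (n + k)%N) (-1) (it n).
have ldif n k : l2C (dif n k) by exact: l2C_lin2.
have difS n k : dif n.+1 k = Rr (dif n k).
  rewrite /dif /Rr shift_lin2// /Rr /lin2.
  by congr pair; apply/funext => x /=; ring.
(* Here s is the Young parameter, D the contribution of w to one iteration, and B is chosen so that
   (1 + s) q B + D <= B, which keeps all iterates in one ball. *)
pose s := (1 - q) / 2; have s0 : 0 < s by rewrite divr_gt0// subr_gt0.
pose D := (1 + s^-1) * t ^+ 2 * ip2 w w.
have D0 : 0 <= D.
  apply: mulr_ge0 (ip2_ge0 _); apply: mulr_ge0 (sqr_ge0 _).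
  by rewrite addr_ge0// invr_ge0 ltW.
pose B := 2 * D / (1 - q).
have q1' : 0 < 1 - q by rewrite subr_gt0.
have B0 : 0 <= B by apply: divr_ge0; [exact: mulr_ge0|exact: ltW].
have itB k : ip2 (it k) (it k) <= B.
  elim: k => [|k IH] /=.
    by rewrite -(lin2_00 w w) ip2_lin2//; lra.
  have lRk := lR _ (lit k); rewrite ip2_lin2//.
  (* Young: [2 t <a, w> <= s |a|^2 + t^2 |w|^2 / s] *)
  have : 0 <= s^-1 * ip2 (lin2 s (Rr (it k)) (- t) w) (lin2 s (Rr (it k)) (- t) w).
    by rewrite mulr_ge0 ?ip2_ge0// invr_ge0 ltW.
  rewrite ip2_lin2//.
  have -> : s^-1 * (s ^+ 2 * ip2 (Rr (it k)) (Rr (it k)) +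
      2 * s * - t * ip2 (Rr (it k)) w + (- t) ^+ 2 * ip2 w w) =
      s * ip2 (Rr (it k)) (Rr (it k)) - 2 * t * ip2 (Rr (it k)) w +
      s^-1 * t ^+ 2 * ip2 w w by field; rewrite gt_eqF.
  have h1 : (1 + s) * ip2 (Rr (it k)) (Rr (it k)) <= (1 + s) * (q * B).
    apply: ler_wpM2l; first exact: addr_ge0 ler01 (ltW s0).
    apply: le_trans (contr _ (lit k)) _.
    by rewrite ler_wpM2l.
  have h2 : (1 + s) * (q * B) + D <= B.
    have DE : D = (1 - q) / 2 * B by rewrite /B; field; rewrite gt_eqF.
    rewrite DE /s -subr_ge0.
    have -> : B - ((1 + (1 - q) / 2) * (q * B) + (1 - q) / 2 * B) =
       (1 - q) ^+ 2 / 2 * B by field.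
    by rewrite mulr_ge0// divr_ge0// sqr_ge0.
  by move: h2; rewrite /D => h2 h3; lra.
have difB n k : ip2 (dif n k) (dif n k) <= B * q ^+ n.
  elim: n => [|n IH].
    rewrite expr0 mulr1; apply: le_trans (itB k); rewrite /dif add0n /=.
    rewrite (_ : lin2 _ _ _ _ = it k)//; case: (it k) => f g.
    by rewrite /lin2 /=; congr pair; apply/funext => x; rewrite mulr0 addr0 mul1r.
  rewrite difS; apply: le_trans (contr _ (ldif n k)) _.
  by rewrite exprS mulrCA ler_wpM2l.
have dif1 n k : ip (dif n k).1 (dif n k).1 <= B * q ^+ n.
  by apply: le_trans (difB n k); rewrite lerDl ip_ge0.
have dif2 n k : ip (dif n k).2 (dif n k).2 <= B * q ^+ n.
  by apply: le_trans (difB n k); rewrite lerDr ip_ge0.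
have lit1 n : l2D (it n).1 by have /l2CP[] := lit n.
have lit2 n : l2D (it n).2 by have /l2CP[] := lit n.
have [v1 [lv1 v10 v1B]] := l2_complete m_gt0 q0 q1 B0 (fun n => (lit1 n).1) dif1.
have [v2 [lv2 v20 v2B]] := l2_complete m_gt0 q0 q1 B0 (fun n => (lit2 n).1) dif2.
have lv : l2C (v1, v2).
  apply/l2CP; split; split=> //= x nO.
    by apply: v10 => n; exact: (lit1 n).2.
  by apply: v20 => n; exact: (lit2 n).2.
exists (v1, v2) => //.
have lTv := l2C_shift lv; have lr := l2C_lin2 1 (-1) lTv lw.
have [M Mp MP] := ip2_shift_bound.
suff /(ip2_eq0 lr) : ip2 (lin2 1 (T (v1, v2)) (-1) w) (lin2 1 (T (v1, v2)) (-1) w) <= 0.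
  case: (T (v1, v2)) => f g; case: (w) => f' g'.
  rewrite /lin2 /= => -[/funeqP E1 /funeqP E2].
  by congr pair; apply/funext => x; [have := E1 x|have := E2 x]; rewrite /=; lra.
have K0 : 0 <= 8 * M * B + 2 * t^-1 ^+ 2 * B.
  have := sqr_ge0 t^-1; have := ltW Mp => M1 t1.
  by apply: addr_ge0; apply: mulr_ge0 => //; exact: mulr_ge0.
apply: (geometric_le0 q0 q1 K0) => n.
have le := l2C_lin2 1 (-1) lv (lit n); set e := lin2 1 (v1, v2) (-1) (it n) in le.
(* Since it (n + 1) - it n = -t (T (it n) - w), the residual of the limit is T applied to the error
   e, minus the nth increment over t; both decay geometrically. *)
have -> : lin2 1 (T (v1, v2)) (-1) w = lin2 1 (T e) (- t^-1) (dif n 1).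
  rewrite /e shift_lin2// /dif addn1 /= /Rr /lin2.
  by congr pair; apply/funext => x /=; field; rewrite gt_eqF.
apply: le_trans (ip2_lin2_le _ _ (l2C_shift le) (ldif n 1%N)) _.
have e1 : ip2 e e <= 4 * B * q ^+ n.
  by rewrite /ip2; have := v1B n; have := v2B n; rewrite /=; lra.
have e2 := ler_wpM2l (ltW Mp) e1; have e3 := MP e le.
have e4 := ler_wpM2l (sqr_ge0 t^-1) (difB n 1%N).
by rewrite sqrrN; lra.
Qed.

Lemma coercive_resolvent : resolvent b m Om z.
Proof.
(* The default value u is never taken on l^2(Om, m), by surjectivity. *)
pose S u := xget u [set v | l2C v /\ T v = u].
have SP u : l2C u -> l2C (S u) /\ T (S u) = u.
  move=> lu; rewrite /S; case: xgetP => [v -> //|nex].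
  by have [v lv Tv] := shift_surj lu; case: (nex v).
exists S; split.
  move=> u lu; have [lS TS] := SP u lu; split=> //.
  have [lST TST] := SP _ (l2C_shift lu); exact: shift_inj.
exists eps^-1 => u lu; have [lS TS] := SP u lu.
rewrite -(ler_pXn2r (n := 2)) ?nnegrE ?l2Cnorm_ge0//; last first.
  by rewrite mulr_ge0 ?l2Cnorm_ge0// invr_ge0 ltW.
rewrite exprMn !l2Cnorm_sqr exprVn mulrC ler_pdivlMr ?exprn_gt0// mulrC.
by have := shift_lower lS; rewrite TS.
Qed.

End Shift.
End DirichletLaplacian.

(** * Bottom of the spectrum *)

Section BottomOfSpectrum.
Variables (R : realType) (X : countType) (b : X -> X -> R) (m : X -> R) (C : R).
Hypotheses (b0 : forall x y, 0 <= b x y) (bC : forall x y, b x y = b y x).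
Hypotheses (bsumm : forall x, summ (b x)) (m_gt0 : forall x, 0 < m x).
Hypotheses (C0 : 0 <= C) (degC : forall x, rsum (b x) <= C * m x).
Variable Om : set X.
Implicit Types f g h : X -> R.
Implicit Types u v w : cfun R X.

Local Notation ip := (wip m).
Local Notation H := (Hop b m).
Local Notation HO := (HDir b m Om).
Local Notation l2D := (l2D m Om).

Let m0 x : 0 <= m x. Proof. exact: ltW. Qed.

Definition rayleigh : set R :=
  [set ip (H f) f / ip f f | f in [set f | l2D f /\ 0 < ip f f]].

Hypothesis l2D_nontrivial : exists2 f, l2D f & 0 < ip f f.

Let mu := inf rayleigh.

Lemma rayleigh_neq0 : rayleigh !=set0.
Proof.
by have [f Df f0] := l2D_nontrivial; exists (ip (H f) f / ip f f), f.
Qed.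

Lemma rayleigh_lbound0 : lbound rayleigh 0.
Proof.
move=> _ [f [[lf _] f0] <-]; apply: divr_ge0; last exact: ltW.
exact: ip_Hop_ge0 b0 bC bsumm m_gt0 degC _ lf.
Qed.

Lemma inf_rayleigh_ge0 : 0 <= mu.
Proof. by apply: lb_le_inf; [exact: rayleigh_neq0|exact: rayleigh_lbound0]. Qed.

Lemma inf_rayleigh_le f : l2D f -> mu * ip f f <= ip (H f) f.
Proof.
move=> Df; have [f0|f0] := leP (ip f f) 0; last first.
  rewrite -ler_pdivlMr//; apply: ge_inf; last by exists f.
  by exists 0; exact: rayleigh_lbound0.
have -> : ip f f = 0 by apply/le_anti; rewrite f0 ip_ge0.
by rewrite mulr0; exact: ip_Hop_ge0 b0 bC bsumm m_gt0 degC _ Df.1.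
Qed.

Let A f x := 1 * HO f x + - mu * f x.

Lemma l2D_A f : l2D f -> l2D (A f).
Proof. by move=> Df; apply: l2D_lin => //; exact: l2D_HDir. Qed.

Lemma ip_A f g : l2D f -> l2D g -> ip (A f) g = ip (H f) g - mu * ip f g.
Proof.
move=> Df Dg; have DH := l2D_HDir b0 bC bsumm m_gt0 degC Df.
by rewrite (ip_linl m0 _ _ DH.1 Df.1 Dg.1) ip_HDir//; ring.
Qed.

Lemma ip_A_ge0 f : l2D f -> 0 <= ip (A f) f.
Proof. by move=> Df; rewrite ip_A// subr_ge0 inf_rayleigh_le. Qed.

(** Cauchy-Schwarz for the positive semidefinite form <A f, g>: it is nonnegative at f + t g for all
    t, and symmetric because H is. *)
Lemma ip_A_CauchySchwarz f g : l2D f -> l2D g ->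
  ip (A f) g ^+ 2 <= ip (A f) f * ip (A g) g.
Proof.
move=> Df Dg; apply: discriminant_le; [exact: ip_A_ge0|exact: ip_A_ge0|move=> t].
have Dfg := l2D_lin m_gt0 1 t Df Dg; have := ip_A_ge0 Dfg.
have DHf := l2D_HDir b0 bC bsumm m_gt0 degC Df.
have DHg := l2D_HDir b0 bC bsumm m_gt0 degC Dg.
rewrite !ip_A// -(ip_HDir b _ Dfg).
have -> : HO (fun x => 1 * f x + t * g x) = fun x => 1 * HO f x + t * HO g x.
  by apply/funext => x; exact: (HDir_lin b0 bC bsumm m_gt0 degC _ _ _ Df Dg).
rewrite (ip_linl m0 _ _ DHf.1 DHg.1 Dfg.1) (ip_sqr_lin m0 _ _ Df.1 Dg.1).
rewrite (ip_linr m0 _ _ Df.1 Dg.1 DHf.1) (ip_linr m0 _ _ Df.1 Dg.1 DHg.1).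
rewrite !ip_HDir// (ip_Hop_sym b0 bC bsumm m_gt0 degC Dg.1 Df.1) (ipC m g).
by lra.
Qed.

(** With g = A f, the preceding lemma reads |g|^4 <= <A f, f> <A g, g>. As mu >= 0, <A g, g> <= <H
    g, g> <= 2 C |g|^2, and a factor |g|^2 cancels. *)
Lemma ip_AA_le f : l2D f -> ip (A f) (A f) <= 2 * C * ip (A f) f.
Proof.
move=> Df; have Dg := l2D_A Df; have CS := ip_A_CauchySchwarz Df Dg.
have A0 := ip_A_ge0 Df; set g := A f in Dg CS A0 *.
have gg : ip (A g) g <= 2 * C * ip g g.
  rewrite ip_A//; have := ip_Hop_le b0 bC bsumm m_gt0 degC Dg.1.
  by have := mulr_ge0 inf_rayleigh_ge0 (ip_ge0 m0 g); lra.
have [g0|g0] := leP (ip g g) 0.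
  by apply: le_trans g0 _; rewrite mulr_ge0// mulr_ge0.
rewrite -(ler_pM2r g0) -expr2 (le_trans CS)//.
by have := ler_wpM2l A0 gg; lra.
Qed.

Lemma inf_rayleigh_spectrum : spectrum b m Om (mu, 0).
Proof.
move=> [S [SP [K SK]]].
have zero0 : l2D (fun=> 0).
  have [f Df _] := l2D_nontrivial; have := l2D_lin m_gt0 0 0 Df Df; congr l2D.
  by apply/funext => x; rewrite !mul0r addr0.
have ip00 : ip (fun=> 0) (fun=> 0) = 0.
  by rewrite /wip -[RHS](@rsum0 R X); apply: eq_rsum => x; rewrite mulr0 mul0r.
have TE f : l2D f -> HDir_shift b m Om (mu, 0) (f, fun=> 0) = (A f, fun=> 0).
  move=> Df; rewrite /HDir_shift /=; congr pair; apply/funext => x.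
    by rewrite /A; ring.
  have := HDir_lin b0 bC bsumm m_gt0 degC 0 0 x Df Df.
  under eq_fun do rewrite !mul0r addr0.
  by move=> ->; ring.
(* The assumed bounded inverse, applied to A f viewed as a complex function with zero imaginary
   part. *)
have bound f : l2D f -> ip f f <= K ^+ 2 * ip (A f) (A f).
  move=> Df; have DA := l2D_A Df.
  have lf : l2C m Om (f, fun=> 0) by apply/l2CP.
  have lA : l2C m Om (A f, fun=> 0) by apply/l2CP.
  have [_ SE _] := SP _ lf; rewrite TE// in SE.
  have := SK _ lA; rewrite SE => h.
  have : l2Cnorm m (f, fun=> 0) ^+ 2 <= (K * l2Cnorm m (A f, fun=> 0)) ^+ 2.
    have n0 := l2Cnorm_ge0 m (f, fun=> 0).
    by rewrite ler_pXn2r// nnegrE// (le_trans n0 h).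
  by rewrite exprMn !(l2Cnorm_sqr m_gt0) /ip2 /= ip00 !addr0.
pose L := K ^+ 2 * (2 * C).
have L0 : 0 <= L by rewrite mulr_ge0 ?sqr_ge0 ?mulr_ge0.
(* From |f|^2 <= L <A f, f>, every Rayleigh quotient would exceed mu by 1 / (L + 1); adding 1 covers
   L = 0. *)
have : mu + (L + 1)^-1 <= mu.
  apply: lb_le_inf; first exact: rayleigh_neq0.
  move=> _ [f [Df f0] <-]; rewrite ler_pdivlMr// mulrDl.
  have h := bound f Df; have h2 := ler_wpM2l (sqr_ge0 K) (ip_AA_le Df).
  have h3 : ip f f <= L * ip (A f) f by rewrite /L; lra.
  have q0 : 0 <= ip (A f) f by rewrite ip_A// subr_ge0 inf_rayleigh_le.
  have : (L + 1)^-1 * ip f f <= ip (A f) f.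
    rewrite mulrC ler_pdivrMr ?ltr_wpDl//; nra.
  by rewrite ip_A//; lra.
have : 0 < (L + 1)^-1 by rewrite invr_gt0 ltr_wpDl.
by lra.
Qed.

End BottomOfSpectrum.

(** * The form bounded by the operator norm *)

Section OperatorNorm.
Variables (R : realType) (X : countType) (b : X -> X -> R) (m : X -> R) (C : R).
Hypotheses (b0 : forall x y, 0 <= b x y) (bC : forall x y, b x y = b y x).
Hypotheses (bsumm : forall x, summ (b x)) (m_gt0 : forall x, 0 < m x).
Hypotheses (C0 : 0 <= C) (degC : forall x, rsum (b x) <= C * m x).
Implicit Types f g h : X -> R.

Local Notation ip := (wip m).
Local Notation H := (Hop b m).

Let m0 x : 0 <= m x. Proof. exact: ltW. Qed.

(** The set defining the norm is bounded by 2 C, so its [sup] is a genuine upper bound. *)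
Lemma Hnorm_ub u : l2C m setT u -> l2Cnorm m u <= 1 ->
  l2Cnorm m (HC b m u) <= Hnorm b m.
Proof.
move=> lu u1; apply: ub_le_sup; last by exists u.
exists (2 * C) => _ [v [/l2CP[[v1 _] [v2 _]] nv] <-].
have C2 : 0 <= 2 * C by rewrite mulr_ge0.
rewrite -(ler_pXn2r (n := 2)) ?nnegrE ?l2Cnorm_ge0//.
rewrite (l2Cnorm_sqr m_gt0) /ip2 /=.
have := ip_HopHop_bound b0 bC bsumm m_gt0 C0 degC v1.
have := ip_HopHop_bound b0 bC bsumm m_gt0 C0 degC v2.
have nv2 : ip v.1 v.1 + ip v.2 v.2 <= 1.
  by rewrite -[leLHS](l2Cnorm_sqr m_gt0 v) expr_le1 ?l2Cnorm_ge0.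
by have := ler_wpM2l (sqr_ge0 (2 * C)) nv2; lra.
Qed.

(** Normalising f gives |H f| <= |H| |f|, and Cauchy-Schwarz concludes; for f of norm zero the
    latter alone makes the form vanish. *)
Lemma ip_Hop_Hnorm f : l2 m f -> ip (H f) f <= Hnorm b m * ip f f.
Proof.
move=> lf; have lH := l2_Hop b0 bC bsumm m_gt0 degC lf.
have CS := ip_CauchySchwarz m0 lH lf.
have [f0|f0] := leP (ip f f) 0.
  have ff : ip f f = 0 by apply/le_anti; rewrite f0 ip_ge0.
  rewrite ff mulr0 in CS; rewrite ff mulr0.
  by have := sqr_ge0 (ip (H f) f); nra.
pose n := Num.sqrt (ip f f); have n0 : 0 < n by rewrite sqrtr_gt0.
have n2 : n ^+ 2 = ip f f by rewrite sqr_sqrtr// ltW.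
pose u : cfun R X := (fun x => n^-1 * f x + 0 * f x, fun x => 0 * f x + 0 * f x).
have lu : l2C m setT u.
  by apply/l2CP; split; split; try exact: l2_lin; move=> x /(_ Logic.I).
have nu : l2Cnorm m u <= 1.
  rewrite -(expr_le1 (n := 2)) ?l2Cnorm_ge0// (l2Cnorm_sqr m_gt0) /ip2 /=.
  rewrite !ip_sqr_lin// -n2 exprVn.
  by rewrite mulVf ?gt_eqF ?exprn_gt0//; lra.
have h := Hnorm_ub lu nu.
have N0 : 0 <= Hnorm b m := le_trans (l2Cnorm_ge0 m _) h.
have HH : ip (H f) (H f) <= Hnorm b m ^+ 2 * ip f f.
  move: h; rewrite -(ler_pXn2r (n := 2)) ?nnegrE ?l2Cnorm_ge0//.
  rewrite (l2Cnorm_sqr m_gt0) /ip2 /= => h.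
  rewrite -n2 -ler_pdivrMr ?exprn_gt0//; apply: le_trans h.
  have E (a : R) : H (fun x => a * f x + 0 * f x) = fun x => a * H f x + 0 * H f x.
    by apply/funext => x; exact: (Hop_lin b0 bC bsumm m_gt0 degC _ _ _ lf lf).
  by rewrite !E !ip_sqr_lin// exprVn; lra.
apply: le_trans (ler_norm _) _.
rewrite -(ler_pXn2r (n := 2)) ?nnegrE ?mulr_ge0 ?(ltW f0)//.
rewrite real_normK ?num_real// (le_trans CS)//.
by rewrite exprMn expr2 mulrA ler_wpM2r// ltW.
Qed.

End OperatorNorm.

(** * The indicator of [Om] as a test function *)

Section TestFunction.
Variables (R : realType) (X : countType) (b : X -> X -> R) (m : X -> R) (C : R).
Hypotheses (b0 : forall x y, 0 <= b x y) (bC : forall x y, b x y = b y x).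
Hypotheses (bsumm : forall x, summ (b x)) (m_gt0 : forall x, 0 < m x).
Hypotheses (C0 : 0 <= C) (degC : forall x, rsum (b x) <= C * m x).
Variable Om : set X.
Hypothesis voloo : (vol m Om < +oo)%E.

Local Notation ip := (wip m).
Local Notation H := (Hop b m).

Let m0 x : 0 <= m x. Proof. exact: ltW. Qed.

Definition chi x : R := if `[< Om x >] then 1 else 0.

Lemma chi_sqr x : chi x ^+ 2 * m x = mOm m Om x.
Proof.
by rewrite /chi /mOm; case: asboolP; rewrite ?expr1n ?expr0n ?mul1r ?mul0r.
Qed.

Lemma l2D_chi : l2D m Om chi.
Proof.
split; last by move=> x nO; rewrite /chi asboolF.
apply/(l2_summ m0); rewrite (_ : (fun x => _) = mOm m Om); first exact: summ_mOm.
by apply/funext => x; exact: chi_sqr.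
Qed.

Lemma ip_chi : ip chi chi = fine (vol m Om).
Proof. by rewrite ip_sqr (eq_rsum chi_sqr) rsum_mOm. Qed.

Lemma fine_vol_gt0 : Om !=set0 -> 0 < fine (vol m Om).
Proof.
move=> [x Ox]; rewrite -rsum_mOm//.
apply: lt_le_trans (le_rsum1 x (mOm_ge0 m_gt0 Om) (summ_mOm m_gt0 voloo)).
by rewrite /mOm asboolT.
Qed.

Hypothesis volXoo : (vol m [set: X] < +oo)%E.
Let v := fine (vol m Om).
Let V := fine (vol m [set: X]).

Lemma vol_summ_m : summ m /\ rsum m = V.
Proof. by split; [apply/(summ_ge0 m0)|rewrite rsum_ge0E]. Qed.

(* [H 1 = 0] and [H] is symmetric, so the form does not see constants. *)
Lemma ip_Hop_chi_le : Om !=set0 -> ip (H chi) chi <= Hnorm b m * (v * ((V - v) / V)).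
Proof.
move=> Om0; have [sm mV] := vol_summ_m; have v0 : 0 < v := fine_vol_gt0 Om0.
have [lchi _] := l2D_chi.
pose one : X -> R := fun=> 1.
have lone : l2 m one.
  by apply/(l2_summ m0); under eq_fun do rewrite /one expr1n mul1r.
have ipone : ip one one = V.
  by rewrite -mV; apply: eq_rsum => x; rewrite /one !mul1r.
have ipchione : ip chi one = v.
  rewrite -[RHS]ip_chi; apply: eq_rsum => x; rewrite /one /chi mulr1.
  by case: asboolP; rewrite ?mul1r ?mul0r.
have V0 : 0 < V.
  apply: lt_le_trans v0 _; rewrite -mV /v -rsum_mOm//; apply: ler_rsum => // [|x].
    exact: summ_mOm.
  by rewrite /mOm; case: ifP.
have H1 : H one = fun=> 0.
  apply/funext => x; rewrite /Hop (@eq_rsum _ _ _ (fun=> 0)) ?rsum0 ?mulr0//.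
  by move=> y; rewrite subrr mulr0.
have ip0 f : ip f (fun=> 0) = 0.
  by rewrite /wip -[RHS](@rsum0 R X); apply: eq_rsum => x; rewrite mulr0 mul0r.
pose g x := 1 * chi x + - (v / V) * one x.
have lg : l2 m g by exact: l2_lin.
have Hg : H g = H chi.
  apply/funext => x; rewrite (Hop_lin b0 bC bsumm m_gt0 degC _ _ _ lchi lone) H1.
  by rewrite mulr0 addr0 mul1r.
have E : ip (H chi) chi = ip (H g) g.
  have lH : l2 m (H chi) by exact: l2_Hop b0 bC bsumm m_gt0 degC _ lchi.
  rewrite Hg (ip_linr m0 _ _ lchi lone lH).
  by rewrite (ip_Hop_sym b0 bC bsumm m_gt0 degC lchi lone) H1 ip0; ring.
have gg : ip g g = v * ((V - v) / V).
  rewrite (ip_sqr_lin m0 _ _ lchi lone) ip_chi ipchione ipone -/v.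
  by field; rewrite gt_eqF.
by rewrite E -gg; exact: ip_Hop_Hnorm b0 bC bsumm m_gt0 C0 degC _ lg.
Qed.

End TestFunction.

Theorem theorem3p2 (R : realType) (X : countType) (b : X -> X -> R) (m : X -> R)
  (Om : set X) :
  weighted_graph b m -> connected_graph b -> condB b m -> condM m ->
  Om !=set0 -> Om <> [set: X] ->
  (vol m Om < +oo)%E -> (inradius b Om < +oo)%E ->
  (1 / (fine (inradius b Om) * fine (vol m Om)) <= lambda b m Om) /\
  ((vol m [set: X] < +oo)%E ->
   lambda b m Om <= Hnorm b m * ((fine (vol m [set: X]) - fine (vol m Om))
                                 / fine (vol m [set: X]))).
Proof.
move=> [b0 [bC [_ [bfin m_gt0]]]] conn [C0 C0P] _ Om0 _ voloo Ioo.
have bsumm x : summ (b x) by apply/(summ_ge0 (b0 x)).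
pose C := `|C0|; have Cge0 : 0 <= C by exact: normr_ge0.
have degC x : rsum (b x) <= C * m x.
  rewrite -ler_pdivrMr// rsum_ge0E//.
  exact: le_trans (C0P x) (ler_norm _).
have v0 : 0 < fine (vol m Om) by exact: fine_vol_gt0.
have nontriv : exists2 f, l2D m Om f & 0 < wip m f f.
  by exists (chi R Om); [exact: l2D_chi|rewrite ip_chi].
have spec := inf_rayleigh_spectrum b0 bC bsumm m_gt0 Cge0 degC nontriv.
set I := fine (inradius b Om); set v := fine (vol m Om) in v0 *.
(* A spectral point with smaller real part would lie in the resolvent set, by coercivity. *)
have lb : lbound [set z.1 | z in spectrum b m Om] (1 / (I * v)).
  move=> _ [z zs <-]; rewrite leNgt; apply/negP => zlt; apply: zs.
  apply: (coercive_resolvent b0 bC bsumm m_gt0 Cge0 degC _ zlt) => f Df.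
  have FK := faber_krahn b0 bC bsumm m_gt0 degC conn Ioo voloo Df.
  have Q0 := ip_Hop_ge0 b0 bC bsumm m_gt0 degC Df.1.
  have I0 : 0 <= I * v by rewrite mulr_ge0 ?fine_inradius_ge0// ltW.
  (* When the product is 0, its inverse is 0 by convention, and the claim is that the form is
     nonnegative. *)
  have [Iv0|Ivn0] := eqVneq (I * v) 0; first by rewrite Iv0 invr0 mulr0 mul0r.
  have Ip : 0 < I * v by rewrite lt_neqAle eq_sym Ivn0.
  by rewrite mul1r mulrC ler_pdivrMr// mulrC.
split.
  apply: lb_le_inf => //.
  by exists (inf (rayleigh b m Om)), (inf (rayleigh b m Om), 0).
move=> volXoo; apply: (@le_trans _ _ (inf (rayleigh b m Om))).
  by apply: ge_inf; [exists (1 / (I * v))|exists (inf (rayleigh b m Om), 0)].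
(* Multiplying by v = |chi|^2 turns the claim into one about the form at [chi]. *)
rewrite -(ler_pM2r v0).
have := inf_rayleigh_le b0 bC bsumm m_gt0 degC (l2D_chi m_gt0 voloo).
rewrite ip_chi// => /le_trans; apply.
apply: le_trans (ip_Hop_chi_le b0 bC bsumm m_gt0 Cge0 degC voloo volXoo Om0) _.
by rewrite -/v le_eqVlt; apply/orP; left; apply/eqP; ring.
Qed.
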